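(* Let $K$ be a field of characteristic zero, $n\geq1$, and let $k=(k_1,\ldots,k_n)\in K^n$ contain exactly $m$ nonzero elements, at the indices $\ell_1<\cdots<\ell_m$. The deformation of $A_n$ into $A_n^k$ induces an $m$-parameter formal hom-Lie deformation of the Lie algebra of $A_n$ into the hom-Lie algebra of $A_n^k$ when the commutator is used as a hom-Lie bracket, in the following sense. For $i=(i_1,\ldots,i_m)\in\mathbb{N}^m$ put $$\alpha_i=\frac{1}{i_1!\cdots i_m!}\Big(\frac{\partial}{\partial y_{\ell_1}}\Big)^{i_1}\cdots\Big(\frac{\partial}{\partial y_{\ell_m}}\Big)^{i_m}\colon A_n\to A_n,\qquad [a,b]_i=\alpha_i(ab-ba),\quad a,b\in A_n.$$ Let $L$ be the vector space $A_n$ with bracket $[a,b]=ab-ba$, a Lie algebra over $K$ (i.e. a hom-Lie algebra with twisting map $\mathrm{id}$). Then $L\llbracket t_1,\ldots,t_m\rrbracket$ with bracket $\sum_{i\in\mathbb{N}^m}\widehat{[\cdot,\cdot]}_it^i$ and twisting map $\sum_{i\in\mathbb{N}^m}\widehat\alpha_it^i$ is an $m$-parameter formal hom-Lie deformation of $L$, and replacing the indeterminates $t_1,\ldots,t_m$ by $k_{\ell_1},\ldots,k_{\ell_m}$ gives the hom-Lie algebra of $A_n^k$: for all $a,b\in A_n$, the sums $\sum_i [a,b]_i\,k_{\ell_1}^{i_1}\cdots k_{\ell_m}^{i_m}$ and $\sum_i\alpha_i(a)k_{\ell_1}^{i_1}\cdots k_{\ell_m}^{i_m}$ are finite and equal $a*b-b*a$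 and $\widehat\alpha_k(a)$, respectively.
   Context: $\mathbb{N}$ includes $0$. The $n$th Weyl algebra $A_n$ over $K$ is the free associative unital $K$-algebra on $x_1,\ldots,x_n,y_1,\ldots,y_n$ modulo the relations $[x_i,x_j]=[y_i,y_j]=0$ and $[x_i,y_j]=\delta_{ij}$ (Kronecker delta, times $1_{A_n}$) for $1\le i,j\le n$. It has $K$-basis the monomials $y_1^{i_1}\cdots y_n^{i_n}x_1^{j_1}\cdots x_n^{j_n}$, and $\partial/\partial y_\ell$ is the formal partial derivative with respect to $y_\ell$ on this basis (equivalently $[x_\ell,\cdot]$). For $k\in K^n$, let $\widehat\alpha_k\colon A_n\to A_n$ be the unital $K$-algebra endomorphism with $\widehat\alpha_k(x_\ell)=x_\ell$ and $\widehat\alpha_k(y_\ell)=y_\ell+k_\ell$. The $n$th hom-associative Weyl algebra $A_n^k$ is the $K$-vector space $A_n$ with multiplication $p*q:=\widehat\alpha_k(pq)$ and twisting map $\widehat\alpha_k$. A hom-Lie algebra over a commutative unital ring $R$ is an $R$-module $L$ with an $R$-bilinear bracket $[\cdot,\cdot]_L$ and an $R$-linear twisting map $\alpha\colon L\to L$ such that $[a,a]_L=0$ and $[\alpha(a),[b,c]_L]_L+[\alpha(c),[a,b]_L]_L+[\alpha(b),[c,a]_L]_L=0$ for all $a,b,c\in L$. The hom-Lie algebra of $A_n^k$ is $A_n$ with bracket $a*b-b*a$ and twisting map $\widehat\alpha_k$. Let $L$ be a hom-Lie algebra over $R$. For $i\in\mathbb{N}^m$ write $t^i=t_1^{i_1}\cdots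 t_m^{i_m}$; $L\llbracket t_1,\ldots,t_m\rrbracket$ consists of formal sums $\sum_{i\in\mathbb{N}^m}a_it^i$, $a_i\in L$. An $R$-bilinear map $[\cdot,\cdot]_i\colon L\times L\to L$ is extended homogeneously by $\widehat{[\sum_ja_jt^j,\sum_lb_lt^l]}_i=\sum_{j,l}[a_j,b_l]_it^{j+l}$, and an $R$-linear map $\alpha_i\colon L\to L$ by $\widehat\alpha_i(\sum_ja_jt^j)=\sum_j\alpha_i(a_j)t^j$. An $m$-parameter formal hom-Lie deformation of $L$ is a hom-Lie algebra $L\llbracket t_1,\ldots,t_m\rrbracket$ over $R\llbracket t_1,\ldots,t_m\rrbracket$ with hom-Lie bracket $\sum_{i\in\mathbb{N}^m}\widehat{[\cdot,\cdot]}_it^i$ and twisting map $\sum_{i\in\mathbb{N}^m}\widehat\alpha_it^i$, where the $[\cdot,\cdot]_i$ are $R$-bilinear, the $\alpha_i$ are $R$-linear, $[\cdot,\cdot]_0$ is the bracket of $L$ and $\alpha_0$ its twisting map. *)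

(* Defs.v *)
(* MathComp, with the classical axioms of mathcomp.classical.boolp. *)
From HB Require Import structures.
From mathcomp Require Import all_boot all_order all_algebra.
From mathcomp Require Import generic_quotient ring_quotient finmap.
From mathcomp Require Import boolp classical_sets cardinality fsbigop.
From mathcomp Require Import monalg.

Set Implicit Arguments.
Unset Strict Implicit.
Unset Printing Implicit Defensive.

Import GRing.Theory.

Local Open Scope ring_scope.
Local Open Scope quotient_scope.

(* Quotient of an algebra by the two-sided ideal generated by rel. *)
Section QuotientType.
Variables (K : comNzRingType) (A : algType K) (rel : A -> Prop).

Inductive in_ideal : A -> Prop :=
| in_ideal0 : in_ideal 0
| in_idealD u r v p : rel r -> in_ideal p -> in_ideal (u * r * v + p).

Lemma in_ideal_add p q : in_ideal p -> in_ideal q -> in_ideal (p + q).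
Proof.
elim=> [|u r v p' hr _ IH] hq; first by rewrite add0r.
by rewrite -addrA; apply: in_idealD => //; exact: IH.
Qed.

Lemma in_ideal_mul a b p : in_ideal p -> in_ideal (a * p * b).
Proof.
elim=> [|u r v q hr _ IH]; first by rewrite mulr0 mul0r; constructor.
rewrite mulrDr mulrDl.
have -> : a * (u * r * v) * b = (a * u) * r * (v * b) by rewrite !mulrA.
exact: in_idealD.
Qed.

Lemma in_ideal_scale c p : in_ideal p -> in_ideal (c *: p).
Proof.
by move=> hp; rewrite -[p]mulr1 -[p]mul1r -mulrA scalerAl mulrA; exact: in_ideal_mul.
Qed.

Definition ideal_pred : {pred A} := fun p => `[< in_ideal p >].

Lemma ideal_pred_zmod_closed : zmod_closed ideal_pred.
Proof.
split=> [|p q /asboolP hp /asboolP hq]; first by apply/asboolP; constructor.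
apply/asboolP/in_ideal_add => //.
by rewrite -scaleN1r; exact: in_ideal_scale.
Qed.

HB.instance Definition _ :=
  GRing.isZmodClosed.Build A ideal_pred ideal_pred_zmod_closed.

Definition quot_alg := Quotient.quot (GRing.ZmodClosed.clone A ideal_pred _).

HB.instance Definition _ := Choice.on quot_alg.
HB.instance Definition _ := EqQuotient.on quot_alg.
HB.instance Definition _ := GRing.Zmodule.on quot_alg.

End QuotientType.

(* The operations are locked: left transparent, a failing unification unfolds
   them down to the free algebra and does not terminate in practice. *)
HB.lock Definition qpi (K : comNzRingType) (A : algType K) (rel : A -> Prop)
  (p : A) : quot_alg rel := \pi_(quot_alg rel) p.

HB.lock Definition qrepr (K : comNzRingType) (A : algType K) (rel : A -> Prop)
  (a : quot_alg rel) : A := repr a.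

HB.lock Definition quot_one (K : comNzRingType) (A : algType K)
  (rel : A -> Prop) : quot_alg rel := qpi rel 1.

HB.lock Definition quot_mul (K : comNzRingType) (A : algType K)
  (rel : A -> Prop) (a b : quot_alg rel) : quot_alg rel :=
  qpi rel (qrepr a * qrepr b).

HB.lock Definition quot_scale (K : comNzRingType) (A : algType K)
  (rel : A -> Prop) (c : K) (a : quot_alg rel) : quot_alg rel :=
  qpi rel (c *: qrepr a).

Section QuotientAlgebra.
Variables (K : comNzRingType) (A : algType K) (rel : A -> Prop).
Local Notation in_ideal := (in_ideal rel).
Local Notation quot_alg := (quot_alg rel).
Local Notation qpi := (qpi rel).
Local Notation quot_one := (quot_one rel).
Local Notation quot_mul := (@quot_mul K A rel).
Local Notation quot_scale := (@quot_scale K A rel).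

Lemma qpiP p q : qpi p = qpi q <-> in_ideal (p - q).
Proof.
rewrite qpi.unlock; split=> [/eqP|h].
  by rewrite -Quotient.idealrBE => /asboolP.
by apply/eqP; rewrite -Quotient.idealrBE; apply/asboolP.
Qed.

Lemma qreprK a : qpi (qrepr a) = a.
Proof. by rewrite qpi.unlock qrepr.unlock reprK. Qed.

Lemma qreprP p : in_ideal (qrepr (qpi p) - p).
Proof. by apply/qpiP; rewrite qreprK. Qed.

Fact qpi_zmod : zmod_morphism qpi.
Proof. by move=> p q; rewrite qpi.unlock raddfB. Qed.

HB.instance Definition _ := GRing.isZmodMorphism.Build A quot_alg qpi qpi_zmod.

Lemma quot_mulE p q : quot_mul (qpi p) (qpi q) = qpi (p * q).
Proof.
rewrite quot_mul.unlock; apply/qpiP; set p' := qrepr _; set q' := qrepr _.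
have -> : p' * q' - p * q = 1 * (p' - p) * q' + p * (q' - q) * 1.
  by rewrite mul1r mulr1 mulrBl mulrBr addrA subrK.
by apply: in_ideal_add; apply: in_ideal_mul; exact: qreprP.
Qed.

Lemma quot_scaleE c p : quot_scale c (qpi p) = qpi (c *: p).
Proof.
rewrite quot_scale.unlock; apply/qpiP; rewrite -scalerBr.
by apply: in_ideal_scale; exact: qreprP.
Qed.

Lemma quot_ind (P : quot_alg -> Prop) : (forall p, P (qpi p)) -> forall a, P a.
Proof. by move=> h a; rewrite -(qreprK a). Qed.

Fact quot_mulA : associative quot_mul.
Proof.
elim/quot_ind=> p; elim/quot_ind=> q; elim/quot_ind=> r.
by rewrite !quot_mulE mulrA.
Qed.
Fact quot_mul1 : left_id quot_one quot_mul.
Proof. by elim/quot_ind=> p; rewrite quot_one.unlock quot_mulE mul1r. Qed.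
Fact quot_1mul : right_id quot_one quot_mul.
Proof. by elim/quot_ind=> p; rewrite quot_one.unlock quot_mulE mulr1. Qed.
Fact quot_mulDl : left_distributive quot_mul +%R.
Proof.
elim/quot_ind=> p; elim/quot_ind=> q; elim/quot_ind=> r.
by rewrite -raddfD !quot_mulE -raddfD mulrDl.
Qed.
Fact quot_mulDr : right_distributive quot_mul +%R.
Proof.
elim/quot_ind=> p; elim/quot_ind=> q; elim/quot_ind=> r.
by rewrite -raddfD !quot_mulE -raddfD mulrDr.
Qed.
Fact quot_scaleA a b v : quot_scale a (quot_scale b v) = quot_scale (a * b) v.
Proof. by elim/quot_ind: v => p; rewrite !quot_scaleE scalerA. Qed.
Fact quot_scale1 : left_id 1 quot_scale.
Proof. by elim/quot_ind=> p; rewrite quot_scaleE scale1r. Qed.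
Fact quot_scaleDr : right_distributive quot_scale +%R.
Proof.
move=> c; elim/quot_ind=> p; elim/quot_ind=> q.
by rewrite -raddfD !quot_scaleE -raddfD scalerDr.
Qed.
Fact quot_scaleDl v : {morph quot_scale^~ v : a b / a + b}.
Proof.
by move=> a b; elim/quot_ind: v => p; rewrite !quot_scaleE -raddfD scalerDl.
Qed.
Fact quot_scaleAl c u v : quot_scale c (quot_mul u v) = quot_mul (quot_scale c u) v.
Proof.
elim/quot_ind: u => p; elim/quot_ind: v => q.
by rewrite !(quot_mulE, quot_scaleE) scalerAl.
Qed.
Fact quot_scaleAr c u v : quot_scale c (quot_mul u v) = quot_mul u (quot_scale c v).
Proof.
elim/quot_ind: u => p; elim/quot_ind: v => q.
by rewrite !(quot_mulE, quot_scaleE) scalerAr.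
Qed.

HB.instance Definition _ := GRing.Zmodule_isPzRing.Build quot_alg
  quot_mulA quot_mul1 quot_1mul quot_mulDl quot_mulDr.
HB.instance Definition _ := GRing.Zmodule_isLmodule.Build K quot_alg
  quot_scaleA quot_scale1 quot_scaleDr quot_scaleDl.

Lemma qpi_rel r : rel r -> qpi r = 0.
Proof.
move=> hr; rewrite -(raddf0 qpi); apply/qpiP; rewrite subr0.
have -> : r = 1 * r * 1 + 0 by rewrite mul1r mulr1 addr0.
by apply: in_idealD => //; constructor.
Qed.
Lemma qpiD p q : qpi (p + q) = qpi p + qpi q. Proof. exact: raddfD. Qed.
Lemma qpiB p q : qpi (p - q) = qpi p - qpi q. Proof. exact: raddfB. Qed.
Lemma qpi1 : qpi 1 = 1.
Proof. by rewrite [RHS](_ : _ = quot_one) // quot_one.unlock. Qed.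
Lemma qpiM p q : qpi (p * q) = qpi p * qpi q.
Proof. by rewrite -quot_mulE. Qed.
Lemma qpiZ c p : qpi (c *: p) = c *: qpi p.
Proof. by rewrite -quot_scaleE. Qed.

End QuotientAlgebra.

(* {fmonom T} is the free monoid on T. *)
Definition free_alg (K : comNzRingType) (T : choiceType) := {malg K[{fmonom T}]}.

HB.lock Definition free_gen (K : comNzRingType) (T : choiceType) (g : T) :
  free_alg K T := << fmu g >>.
Arguments free_gen K {T} g.

Section FreeAlgebra.
Variables (K : comNzRingType) (T : choiceType).

Local Notation free_alg := (free_alg K T).
Local Notation free_gen := (@free_gen K T).

HB.instance Definition _ := GRing.Lalgebra.on free_alg.

Fact free_alg_scaleAr (c : K) (p q : free_alg) : c *: (p * q) = p * (c *: q).
Proof.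
rewrite [RHS](malgMEw (fsubset_refl _) (msuppZ_le c q)) malgME scaler_sumr.
apply: eq_bigr => w _; rewrite scaler_sumr; apply: eq_bigr => z _.
by rewrite mcoeffZ -mul_malgC malgM_def fgmulUU mul1m mulrCA.
Qed.

HB.instance Definition _ :=
  GRing.Lalgebra_isAlgebra.Build K free_alg free_alg_scaleAr.

Lemma free_alg_ind (P : free_alg -> Prop) :
    P 1 -> (forall g p, P p -> P (free_gen g * p)) ->
    (forall c p q, P p -> P q -> P (c *: p + q)) ->
  forall p, P p.
Proof.
move=> P1 Pg PD p; have P0 : P 0.
  by have := PD (-1) 1 1 P1 P1; rewrite scaleN1r addNr.
have Pw (w : {fmonom T}) : P << w >>.
  rewrite -(fmK w); elim: (w : seq T) => [|g s IH].
    have -> : FMonom [::] = mone :> {fmonom T} by apply: val_inj; rewrite /= fm1.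
    exact: P1.
  suff -> : << FMonom (g :: s) >> = free_gen g * << FMonom s >> by exact: Pg.
  rewrite free_gen.unlock malgM_def fgmulUU mulr1; congr << _ >>.
  by apply: val_inj; rewrite /= fmM fmU.
rewrite [p]monalgE; elim: (X in \sum_(k <- X) _) => [|w s IH].
  by rewrite big_nil.
rewrite big_cons; suff -> : << p@_w *g w >> = p@_w *: << w >> by exact: PD.
by apply/malgP=> z; rewrite mcoeffZ !mcoeffU mulr_natr.
Qed.

Section Action.
Variables (V : lmodType K) (f : T -> V -> V).

Definition act_word (w : {fmonom T}) (v : V) : V :=
  foldr (fun g u => f g u) v (w : seq T).

Definition act_free (p : free_alg) (v : V) : V :=
  \sum_(w <- msupp p) p@_w *: act_word w v.

Lemma act_freeEw (d : {fset {fmonom T}}) (p : free_alg) v :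
  (msupp p `<=` d)%fset -> act_free p v = \sum_(w <- d) p@_w *: act_word w v.
Proof.
move=> le; rewrite /act_free (big_fset_incl _ le) //= => w _ /mcoeff_outdom ->.
by rewrite scale0r.
Qed.

Lemma act_freeD p q v : act_free (p + q) v = act_free p v + act_free q v.
Proof.
rewrite (act_freeEw _ (msuppD_le p q)).
rewrite (act_freeEw v (fsubsetUl (msupp p) (msupp q))).
rewrite (act_freeEw v (fsubsetUr (msupp p) (msupp q))) -big_split /=.
by apply: eq_bigr => w _; rewrite mcoeffD scalerDl.
Qed.

Lemma act_freeZ c p v : act_free (c *: p) v = c *: act_free p v.
Proof.
rewrite (act_freeEw _ (msuppZ_le c p)) scaler_sumr.
by apply: eq_bigr => w _; rewrite mcoeffZ scalerA.
Qed.

Lemma act_freeN p v : act_free (- p) v = - act_free p v.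
Proof. by rewrite -(scaleN1r p) act_freeZ scaleN1r. Qed.

Lemma act_freeU c w v : act_free << c *g w >> v = c *: act_word w v.
Proof. by rewrite (act_freeEw _ msuppU_le) big_seq_fset1 mcoeffUU. Qed.

Lemma act_free0 v : act_free 0 v = 0.
Proof. by rewrite -(scale0r (0 : free_alg)) act_freeZ scale0r. Qed.

Lemma act_free_sum (I : Type) (s : seq I) (F : I -> free_alg) v :
  act_free (\sum_(i <- s) F i) v = \sum_(i <- s) act_free (F i) v.
Proof.
exact: (big_morph (act_free^~ v) (fun p q => act_freeD p q v) (act_free0 v)).
Qed.

Lemma act_free1 v : act_free 1 v = v.
Proof. by rewrite act_freeU scale1r /act_word fm1. Qed.

Lemma act_free_gen g v : act_free (free_gen g) v = f g v.
Proof. by rewrite free_gen.unlock act_freeU scale1r /act_word fmU. Qed.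

Hypothesis f_lin : forall g, linear (f g).

Lemma act_word_lin w : linear (act_word w).
Proof.
rewrite /act_word; elim: (w : seq T) => //= g s IH c u v.
by rewrite IH f_lin.
Qed.

Lemma act_free_lin p : linear (act_free p).
Proof.
move=> c u v; rewrite /act_free scaler_sumr -big_split /=.
apply: eq_bigr => w _; rewrite act_word_lin scalerDr !scalerA.
by rewrite [c * _]mulrC.
Qed.

Lemma act_free_v0 p : act_free p 0 = 0.
Proof.
have := act_free_lin p (-1) 0 0; rewrite scaleN1r oppr0 addr0 => ->.
by rewrite scaleN1r addNr.
Qed.

Lemma act_freeM p q v : act_free (p * q) v = act_free p (act_free q v).
Proof.
rewrite malgME act_free_sum [RHS]/act_free; apply: eq_bigr => w _.
rewrite act_free_sum /act_free.
have wl := act_word_lin w.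
have w0 : act_word w 0 = 0.
  by have := wl (-1) 0 0; rewrite scaleN1r oppr0 addr0 => ->; rewrite scaleN1r addNr.
have wD u z : act_word w (u + z) = act_word w u + act_word w z.
  by have := wl 1 u z; rewrite !scale1r.
have wZ c u : act_word w (c *: u) = c *: act_word w u.
  by have := wl c u 0; rewrite !addr0 w0 addr0.
rewrite (big_morph _ wD w0) scaler_sumr; apply: eq_bigr => z _.
rewrite -/(act_free _ _) act_freeU wZ scalerA; congr (_ *: _).
by rewrite /act_word fmM foldr_cat.
Qed.

Lemma act_free_ideal (rel : free_alg -> Prop) p v :
    (forall r u, rel r -> act_free r u = 0) ->
  in_ideal rel p -> act_free p v = 0.
Proof.
move=> rel0; elim=> [|u r w q hr _ IH]; first exact: act_free0.
by rewrite act_freeD IH addr0 !act_freeM (rel0 _ _ hr) act_free_v0.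
Qed.

Lemma act_qrepr (rel : free_alg -> Prop) p v :
    (forall r u, rel r -> act_free r u = 0) ->
  act_free (qrepr (qpi rel p)) v = act_free p v.
Proof.
move=> rel0; have := act_free_ideal v rel0 (qreprP rel p).
by rewrite act_freeD act_freeN => /eqP; rewrite subr_eq0 => /eqP.
Qed.

End Action.
End FreeAlgebra.

(* [x_i, x_j] = [y_i, y_j] = 0 and [x_i, y_j] = delta_ij. *)
Section WeylRelations.
Variables (K : comNzRingType) (F : algType K) (n : nat) (x y : 'I_n -> F).

Inductive weyl_rel : F -> Prop :=
| weyl_rel_xx i j : weyl_rel (x i * x j - x j * x i)
| weyl_rel_yy i j : weyl_rel (y i * y j - y j * y i)
| weyl_rel_xy i j : weyl_rel (x i * y j - y j * x i - (i == j)%:R).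

Local Notation pi := (qpi weyl_rel).

Fact weyl_rel_xC i j : pi (x i) * pi (x j) = pi (x j) * pi (x i).
Proof. by apply: subr0_eq; rewrite -!qpiM -qpiB qpi_rel //; constructor. Qed.

Fact weyl_rel_yC i j : pi (y i) * pi (y j) = pi (y j) * pi (y i).
Proof. by apply: subr0_eq; rewrite -!qpiM -qpiB qpi_rel //; constructor. Qed.

Fact weyl_rel_xyC i j :
  pi (x i) * pi (y j) = pi (y j) * pi (x i) + (i == j)%:R.
Proof.
have -> : (i == j)%:R = pi (i == j)%:R by case: eqP; rewrite ?raddf0 ?qpi1.
apply: subr0_eq; rewrite opprD addrA -!qpiM -!qpiB qpi_rel //; constructor.
Qed.

End WeylRelations.

Section WeylAlgebra.
Variables (K : fieldType) (n : nat).

(* The letters inl i and inr i stand for x_i and y_i respectively. *)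
Definition weyl_letter := ('I_n + 'I_n)%type.

Definition free_x (i : 'I_n) : free_alg K weyl_letter := free_gen K (inl i).
Definition free_y (i : 'I_n) : free_alg K weyl_letter := free_gen K (inr i).

Definition weyl := quot_alg (weyl_rel free_x free_y).

HB.instance Definition _ := GRing.PzRing.on weyl.
HB.instance Definition _ := GRing.Lmodule.on weyl.

Local Notation weyl_pi := (qpi (weyl_rel free_x free_y)).

Definition weyl_x (i : 'I_n) : weyl := weyl_pi (free_x i).
Definition weyl_y (i : 'I_n) : weyl := weyl_pi (free_y i).

Lemma weyl_ind (P : weyl -> Prop) :
    P 1 -> (forall i a, P a -> P (weyl_x i * a)) ->
    (forall i a, P a -> P (weyl_y i * a)) ->
    (forall c a b, P a -> P b -> P (c *: a + b)) ->
  forall a, P a.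
Proof.
move=> P1 Px Py PD; elim/quot_ind; elim/free_alg_ind => [|g p|c p q].
- by rewrite qpi1.
- by case: g => i Pp; rewrite qpiM; [exact: Px | exact: Py].
by move=> Pp Pq; rewrite qpiD qpiZ; exact: PD.
Qed.

Section Action.
Variables (V : lmodType K) (f : weyl_letter -> V -> V).
Hypothesis f_lin : forall g, linear (f g).
Hypothesis f_xx : forall i j v, f (inl i) (f (inl j) v) = f (inl j) (f (inl i) v).
Hypothesis f_yy : forall i j v, f (inr i) (f (inr j) v) = f (inr j) (f (inr i) v).
Hypothesis f_xy : forall i j v,
  f (inl i) (f (inr j) v) = f (inr j) (f (inl i) v) + (i == j)%:R *: v.

Definition weyl_act (a : weyl) (v : V) : V := act_free f (qrepr a) v.

Lemma act_weyl_rel r v : weyl_rel free_x free_y r -> act_free f r v = 0.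
Proof.
case=> i j; rewrite !(act_freeD, act_freeN, act_freeM f_lin, act_free_gen).
- by rewrite f_xx subrr.
- by rewrite f_yy subrr.
rewrite f_xy [X in X - _]addrAC subrr add0r.
by case: eqP => _; rewrite ?act_free0 ?act_free1 ?scale1r ?scale0r subrr.
Qed.

Lemma weyl_act_pi p v : weyl_act (weyl_pi p) v = act_free f p v.
Proof. by apply: act_qrepr => // r u; exact: act_weyl_rel. Qed.

Lemma weyl_actD a b v : weyl_act (a + b) v = weyl_act a v + weyl_act b v.
Proof.
elim/quot_ind: a => p; elim/quot_ind: b => q.
by rewrite -[_ + _](raddfD weyl_pi p q) !weyl_act_pi act_freeD.
Qed.

Lemma weyl_actZ c a v : weyl_act (c *: a) v = c *: weyl_act a v.
Proof.
by elim/quot_ind: a => p; rewrite -[_ *: _]qpiZ !weyl_act_pi act_freeZ.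
Qed.

Lemma weyl_actM a b v : weyl_act (a * b) v = weyl_act a (weyl_act b v).
Proof.
elim/quot_ind: a => p; elim/quot_ind: b => q.
by rewrite -[_ * _]qpiM !weyl_act_pi act_freeM.
Qed.

Lemma weyl_act1 v : weyl_act 1 v = v.
Proof. by rewrite -[1]qpi1 weyl_act_pi act_free1. Qed.

Lemma weyl_act_x i v : weyl_act (weyl_x i) v = f (inl i) v.
Proof. by rewrite weyl_act_pi act_free_gen. Qed.

Lemma weyl_act_y i v : weyl_act (weyl_y i) v = f (inr i) v.
Proof. by rewrite weyl_act_pi act_free_gen. Qed.

Lemma weyl_act_lin a : linear (weyl_act a).
Proof. exact: act_free_lin. Qed.

End Action.
End WeylAlgebra.

From mathcomp Require Import mpoly.

Section WeylBasis.
Variables (K : fieldType) (n : nat).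
Local Notation weyl := (weyl K n).
Local Notation weyl_x := (@weyl_x K n).
Local Notation weyl_y := (@weyl_y K n).

(* Commutative polynomials in n + n variables hold the coordinates in the
   basis of ordered monomials: 'X_(lshift n i) stands for y_i and
   'X_(rshift n i) for x_i. *)
Local Notation coords := {mpoly K[n + n]}.

(* The action of the generators on the coordinates of a under left
   multiplication: y_i multiplies by its variable, and since
   x_i y = y x_i + dy/dy_i for y in K[y_1, ..., y_n], x_i acts as its variable
   plus the derivation in y_i. *)
Definition coord_op (g : weyl_letter n) (p : coords) : coords :=
  match g with
  | inl i => 'X_(rshift n i) * p + p^`M(lshift n i)
  | inr i => 'X_(lshift n i) * p
  end.

Fact coord_op_lin g : linear (coord_op g).
Proof.
case: g => i c p q /=; rewrite ?linearP /= mulrDr -scalerAr //.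
by rewrite scalerDr addrACA.
Qed.

Fact mderiv_U (i j : 'I_(n + n)) : ('X_i : coords)^`M(j) = (j == i)%:R.
Proof.
rewrite mderivX mnm1E eq_sym; case: eqP => [->|_]; last by rewrite scale0r.
by rewrite scale1r; have -> : (U_(i) - U_(i) = 0)%MM; 
  [apply/mnmP=> l; rewrite mnmBE mnm0E subnn | rewrite mpolyX0].
Qed.

Fact coord_op_xx i j p :
  coord_op (inl i) (coord_op (inl j) p) = coord_op (inl j) (coord_op (inl i) p).
Proof.
rewrite /= !mderivD !mderivM !mderiv_U !eq_lrshift !mul0r !add0r !mulrDr.
rewrite mulrCA mderiv_comm -!addrA; congr (_ + _).
by rewrite addrA [X in X + _]addrC -addrA.
Qed.

Fact coord_op_yy i j p :
  coord_op (inr i) (coord_op (inr j) p) = coord_op (inr j) (coord_op (inr i) p).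
Proof. by rewrite /= mulrCA. Qed.

Fact coord_op_xy i j p : coord_op (inl i) (coord_op (inr j) p) =
  coord_op (inr j) (coord_op (inl i) p) + (i == j)%:R *: p.
Proof.
rewrite /= mderivM mderiv_U (inj_eq (@lshift_inj _ _)) mulrDr mulrCA -addrA.
by congr (_ + _); rewrite addrC scaler_nat mulr_natl.
Qed.

(* The coordinates of a = a * 1; weyl_coordK and weyl_of_coordK below state that
   the ordered monomials form a basis and that these are the coordinates. *)
Definition weyl_coord (a : weyl) : coords := weyl_act coord_op a 1.

Fact weyl_one_neq0 : 1 != 0 :> weyl.
Proof.
apply/eqP=> /(congr1 weyl_coord).
have act1 := weyl_act1 coord_op_lin coord_op_xx coord_op_yy coord_op_xy.
have actZ := weyl_actZ coord_op_lin coord_op_xx coord_op_yy coord_op_xy.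
rewrite /weyl_coord act1 -[X in weyl_act _ X _](scale0r (1 : weyl)) actZ scale0r.
by move/eqP; rewrite oner_eq0.
Qed.

HB.instance Definition _ := GRing.PzSemiRing_isNonZero.Build weyl weyl_one_neq0.
HB.instance Definition _ := GRing.Lmodule_isLalgebra.Build K weyl
  (@quot_scaleAl K _ (weyl_rel (@free_x K n) (@free_y K n))).
HB.instance Definition _ := GRing.Lalgebra_isAlgebra.Build K weyl
  (@quot_scaleAr K _ (weyl_rel (@free_x K n) (@free_y K n))).

End WeylBasis.
Section WeylUniversal.
Variables (K : fieldType) (n : nat).
Local Notation weyl := (weyl K n).
Local Notation weyl_x := (@weyl_x K n).
Local Notation weyl_y := (@weyl_y K n).
Local Notation weyl_pi := (qpi (weyl_rel (@free_x K n) (@free_y K n))).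

Lemma weyl_xC i j : weyl_x i * weyl_x j = weyl_x j * weyl_x i.
Proof. exact: weyl_rel_xC. Qed.

Lemma weyl_yC i j : weyl_y i * weyl_y j = weyl_y j * weyl_y i.
Proof. exact: weyl_rel_yC. Qed.

Lemma weyl_xyC i j : weyl_x i * weyl_y j = weyl_y j * weyl_x i + (i == j)%:R.
Proof. exact: weyl_rel_xyC. Qed.

Section Lift.
Variables (B : algType K) (x y : 'I_n -> B).
Hypothesis xC : forall i j, x i * x j = x j * x i.
Hypothesis yC : forall i j, y i * y j = y j * y i.
Hypothesis xyC : forall i j, x i * y j = y j * x i + (i == j)%:R.

Definition lift_op (g : weyl_letter n) (b : B) : B :=
  match g with inl i => x i * b | inr i => y i * b end.

(* The unital algebra morphism sending weyl_x i to x i and weyl_y i to y i,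
   computed by letting the generators act on B by left multiplication. *)
Definition weyl_lift (a : weyl) : B := weyl_act lift_op a 1.

Fact lift_op_lin g : linear (lift_op g).
Proof. by case: g => i c u v /=; rewrite mulrDr scalerAr. Qed.
Fact lift_op_xx i j v :
  lift_op (inl i) (lift_op (inl j) v) = lift_op (inl j) (lift_op (inl i) v).
Proof. by rewrite /= !mulrA xC. Qed.
Fact lift_op_yy i j v :
  lift_op (inr i) (lift_op (inr j) v) = lift_op (inr j) (lift_op (inr i) v).
Proof. by rewrite /= !mulrA yC. Qed.
Fact lift_op_xy i j v : lift_op (inl i) (lift_op (inr j) v) =
  lift_op (inr j) (lift_op (inl i) v) + (i == j)%:R *: v.
Proof. by rewrite /= !mulrA xyC mulrDl scaler_nat mulr_natl. Qed.

Fact lift_actE a b : weyl_act lift_op a b = weyl_lift a * b.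
Proof.
rewrite /weyl_lift /weyl_act /act_free mulr_suml; apply: eq_bigr => w _.
rewrite -scalerAl; congr (_ *: _); rewrite /act_word.
elim: (w : seq _) => [|g s IH] /=; first by rewrite mul1r.
by rewrite IH; case: g => i /=; rewrite mulrA.
Qed.

Fact weyl_lift_linear : linear weyl_lift.
Proof.
move=> c a b; rewrite /weyl_lift.
rewrite (weyl_actD lift_op_lin lift_op_xx lift_op_yy lift_op_xy).
by rewrite (weyl_actZ lift_op_lin lift_op_xx lift_op_yy lift_op_xy).
Qed.

Fact weyl_lift_monoid_morphism : monoid_morphism weyl_lift.
Proof.
split=> [|a b].
  exact: (weyl_act1 lift_op_lin lift_op_xx lift_op_yy lift_op_xy).
rewrite /weyl_lift (weyl_actM lift_op_lin lift_op_xx lift_op_yy lift_op_xy).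
exact: lift_actE.
Qed.

Lemma weyl_lift_x i : weyl_lift (weyl_x i) = x i.
Proof.
by rewrite /weyl_lift (weyl_act_x lift_op_lin lift_op_xx lift_op_yy lift_op_xy) /= mulr1.
Qed.

Lemma weyl_lift_y i : weyl_lift (weyl_y i) = y i.
Proof.
by rewrite /weyl_lift (weyl_act_y lift_op_lin lift_op_xx lift_op_yy lift_op_xy) /= mulr1.
Qed.

End Lift.

Section Shift.
Variable k : 'I_n -> K.

(* The endomorphism fixing the x_i and sending y_i to y_i + k_i. *)
Definition weyl_shift : weyl -> weyl :=
  weyl_lift weyl_x (fun i => weyl_y i + (k i)%:A).

Fact shift_yC i j : (weyl_y i + (k i)%:A) * (weyl_y j + (k j)%:A) =
  (weyl_y j + (k j)%:A) * (weyl_y i + (k i)%:A).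
Proof.
have kC l (b : weyl) : (k l)%:A * b = b * (k l)%:A.
  by rewrite -scalerAl -scalerAr mul1r mulr1.
by rewrite !mulrDl !mulrDr weyl_yC (kC i (weyl_y j)) (kC j (weyl_y i)) (kC j (k i)%:A) addrACA.
Qed.

Fact shift_xyC i j : weyl_x i * (weyl_y j + (k j)%:A) =
  (weyl_y j + (k j)%:A) * weyl_x i + (i == j)%:R.
Proof.
by rewrite mulrDr mulrDl weyl_xyC addrAC -scalerAr mulr1 -scalerAl mul1r.
Qed.

HB.instance Definition _ := GRing.isLinear.Build K weyl weyl _ weyl_shift
  (weyl_lift_linear weyl_xC shift_yC shift_xyC).
HB.instance Definition _ := GRing.isMonoidMorphism.Build weyl weyl weyl_shift
  (weyl_lift_monoid_morphism weyl_xC shift_yC shift_xyC).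

Lemma weyl_shift_x i : weyl_shift (weyl_x i) = weyl_x i.
Proof. exact: (weyl_lift_x weyl_xC shift_yC shift_xyC). Qed.

Lemma weyl_shift_y i : weyl_shift (weyl_y i) = weyl_y i + (k i)%:A.
Proof. exact: (weyl_lift_y weyl_xC shift_yC shift_xyC). Qed.

Definition weyl_hom_mul (a b : weyl) : weyl := weyl_shift (a * b).

End Shift.
End WeylUniversal.

Section WeylMonomials.
Variables (K : fieldType) (n : nat).
Local Notation weyl := (weyl K n).
Local Notation weyl_x := (@weyl_x K n).
Local Notation weyl_y := (@weyl_y K n).
Local Notation coords := {mpoly K[n + n]}.
Local Notation gact := (weyl_act (@coord_op K n)).

Definition weyl_gen (i : 'I_(n + n)) : weyl :=
  match split i with inl l => weyl_y l | inr l => weyl_x l end.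

(* The product is ordered: y_1^(i_1) ... y_n^(i_n) x_1^(j_1) ... x_n^(j_n). *)
Definition weyl_monomial (m : 'X_{1..n + n}) : weyl :=
  \prod_(i < n + n) weyl_gen i ^+ m i.

Definition weyl_of_coord (p : coords) : weyl := mmap (in_alg weyl) weyl_gen p.

Lemma weyl_of_coordE (p : coords) :
  weyl_of_coord p = \sum_(m <- msupp p) p@_m *: weyl_monomial m.
Proof. by apply: eq_bigr => m _; rewrite mulr_algl. Qed.

Lemma weyl_of_coordX m : weyl_of_coord 'X_[m] = weyl_monomial m.
Proof. exact: mmapX. Qed.

Fact weyl_of_coord_linear : linear weyl_of_coord.
Proof. by move=> c p q; rewrite /weyl_of_coord mmapD mmapZ mulr_algl. Qed.

HB.instance Definition _ :=
  GRing.isLinear.Build K coords weyl _ weyl_of_coord weyl_of_coord_linear.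

Let actD := weyl_actD (@coord_op_lin K n) (@coord_op_xx K n) (@coord_op_yy K n)
  (@coord_op_xy K n).
Let actZ := weyl_actZ (@coord_op_lin K n) (@coord_op_xx K n) (@coord_op_yy K n)
  (@coord_op_xy K n).
Let actM := weyl_actM (@coord_op_lin K n) (@coord_op_xx K n) (@coord_op_yy K n)
  (@coord_op_xy K n).
Let act1 := weyl_act1 (@coord_op_lin K n) (@coord_op_xx K n) (@coord_op_yy K n)
  (@coord_op_xy K n).
Let act_x := weyl_act_x (@coord_op_lin K n) (@coord_op_xx K n) (@coord_op_yy K n)
  (@coord_op_xy K n).
Let act_y := weyl_act_y (@coord_op_lin K n) (@coord_op_xx K n) (@coord_op_yy K n)
  (@coord_op_xy K n).

Fact weyl_coord_linear : linear (@weyl_coord K n).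
Proof. by move=> c a b; rewrite /weyl_coord actD actZ. Qed.

HB.instance Definition _ :=
  GRing.isLinear.Build K weyl coords _ (@weyl_coord K n) weyl_coord_linear.

Lemma weyl_monomialE m : weyl_monomial m =
  (\prod_(l < n) weyl_y l ^+ m (lshift n l)) *
  (\prod_(l < n) weyl_x l ^+ m (rshift n l)).
Proof.
rewrite /weyl_monomial big_split_ord /=; congr (_ * _); apply: eq_bigr => l _.
  by rewrite /weyl_gen (unsplitK (inl l)).
by rewrite /weyl_gen (unsplitK (inr l)).
Qed.

Fact act_y_exp l e p : gact (weyl_y l ^+ e) p = 'X_(lshift n l) ^+ e * p.
Proof.
elim: e p => [|e IH] p; first by rewrite !expr0 act1 mul1r.
by rewrite exprS actM IH act_y /= exprS mulrA.
Qed.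

Fact act_y_prod (r : seq 'I_n) (e : 'I_n -> nat) p :
  gact (\prod_(l <- r) weyl_y l ^+ e l) p =
  (\prod_(l <- r) 'X_(lshift n l) ^+ e l) * p.
Proof.
elim: r p => [|l r IH] p; first by rewrite !big_nil act1 mul1r.
by rewrite !big_cons actM IH act_y_exp mulrA.
Qed.

Fact act_x_exp l e p : (forall i, p^`M(lshift n i) = 0) ->
  gact (weyl_x l ^+ e) p = 'X_(rshift n l) ^+ e * p /\
  (forall i, ('X_(rshift n l) ^+ e * p)^`M(lshift n i) = 0).
Proof.
move=> p0; elim: e => [|e [IH IH0]].
  by rewrite !expr0 act1 mul1r; split.
rewrite exprS actM IH act_x /= IH0 addr0 exprS -mulrA; split=> // i.
by rewrite mderivM IH0 mulr0 addr0 mderiv_U eq_lrshift mul0r.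
Qed.

Fact act_x_prod (r : seq 'I_n) (e : 'I_n -> nat) :
  gact (\prod_(l <- r) weyl_x l ^+ e l) 1 =
    \prod_(l <- r) 'X_(rshift n l) ^+ e l /\
  (forall i, (\prod_(l <- r) 'X_(rshift n l) ^+ e l : coords)^`M(lshift n i) = 0).
Proof.
elim: r => [|l r [IH IH0]].
  by rewrite !big_nil act1; split=> // i; rewrite -mpolyC1 mderivC.
by rewrite !big_cons actM IH; exact: act_x_exp.
Qed.

Lemma weyl_coord_monomial m : weyl_coord (weyl_monomial m) = 'X_[m].
Proof.
rewrite /weyl_coord weyl_monomialE actM (act_x_prod _ _).1 act_y_prod.
by rewrite mpolyXE_id big_split_ord.
Qed.

Lemma weyl_of_coordK : cancel weyl_of_coord (@weyl_coord K n).
Proof.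
move=> p; rewrite weyl_of_coordE linear_sum [RHS]mpolyE.
by apply: eq_bigr => m _; rewrite linearZ /= weyl_coord_monomial.
Qed.

Fact prod_commS (z : 'I_n -> weyl) (r : seq 'I_n) (e : 'I_n -> nat) l :
    (forall i j, z i * z j = z j * z i) -> uniq r -> l \in r ->
  z l * (\prod_(i <- r) z i ^+ e i) = \prod_(i <- r) z i ^+ (e i + (l == i)).
Proof.
move=> zC; elim: r => //= h r IH /andP[hr ur]; rewrite inE !big_cons.
case: eqVneq => [->|ne] /= lr.
  rewrite addn1 exprS mulrA; congr (_ * _); apply: eq_big_seq => i ir.
  by case: eqVneq ir hr => [-> ->|]; rewrite ?addn0.
rewrite addn0 mulrA [z l * _](commrX _ (zC l h)) -mulrA.
by rewrite IH.
Qed.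

Fact x_y_exp i j e : weyl_x i * weyl_y j ^+ e =
  weyl_y j ^+ e * weyl_x i + (e * (i == j))%:R *: weyl_y j ^+ e.-1.
Proof.
elim: e => [|e IH]; first by rewrite mul0n scale0r addr0 !expr0 mul1r mulr1.
rewrite exprS mulrA weyl_xyC mulrDl -mulrA IH mulrDr mulrA -exprS -addrA.
congr (_ + _); rewrite -scalerAr mulSn natrD scalerDl addrC.
case: eqVneq => _; last by rewrite muln0 !scale0r mul0r addr0.
rewrite muln1 scale1r mul1r; congr (_ + _).
by case: e {IH} => [|e]; rewrite ?scale0r //= -exprS.
Qed.

Fact x_y_prod_notin (r : seq 'I_n) (e : 'I_n -> nat) i : i \notin r ->
  weyl_x i * (\prod_(j <- r) weyl_y j ^+ e j) =
  (\prod_(j <- r) weyl_y j ^+ e j) * weyl_x i.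
Proof.
elim: r => [|h r IH]; first by rewrite !big_nil mulr1 mul1r.
rewrite inE negb_or !big_cons => /andP[/negPf ih ir].
by rewrite mulrA x_y_exp ih muln0 scale0r addr0 -!mulrA IH.
Qed.

Fact x_y_prod (r : seq 'I_n) (e : 'I_n -> nat) i : uniq r -> i \in r ->
  weyl_x i * (\prod_(j <- r) weyl_y j ^+ e j) =
  (\prod_(j <- r) weyl_y j ^+ e j) * weyl_x i +
  (e i)%:R *: (\prod_(j <- r) weyl_y j ^+ (e j - (i == j))).
Proof.
elim: r => //= h r IH /andP[hr ur]; rewrite inE !big_cons.
case: eqVneq => [->|ne] /= ir; rewrite mulrA x_y_exp.
  rewrite eqxx muln1 mulrDl -!mulrA x_y_prod_notin // -scalerAl subn1.
  congr (_ + _ *: (_ * _)); apply: eq_big_seq => j jr.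
  by case: eqVneq jr hr => [-> ->|]; rewrite ?subn0.
rewrite (negPf ne) muln0 scale0r addr0 -mulrA IH // mulrDr mulrA subn0.
by rewrite -scalerAr.
Qed.

Fact y_of_coord l p : weyl_of_coord (coord_op (inr l) p) = weyl_y l * weyl_of_coord p.
Proof.
rewrite [p]mpolyE /= mulr_sumr !linear_sum /= mulr_sumr; apply: eq_bigr => m _.
rewrite -scalerAr !linearZ /= -mpolyXD !weyl_of_coordX -scalerAr; congr (_ *: _).
rewrite !weyl_monomialE mulrA (prod_commS _ (@weyl_yC K n)) ?index_enum_uniq ?mem_index_enum //.
congr (_ * _); apply: eq_bigr => i _; rewrite mnmDE mnm1E.
  by rewrite (inj_eq (@lshift_inj _ _)) addnC.
by rewrite eq_lrshift add0n.
Qed.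

Fact x_of_coord l p : weyl_of_coord (coord_op (inl l) p) = weyl_x l * weyl_of_coord p.
Proof.
rewrite [p]mpolyE /= mulr_sumr !linear_sum /= mulr_sumr -big_split /=.
rewrite linear_sum; apply: eq_bigr => m _.
rewrite -scalerAr mderivZ mderivX -scalerDr !linearZ /= -scalerAr linearD linearZ /=.
rewrite -mpolyXD !weyl_of_coordX; congr (_ *: _).
rewrite !weyl_monomialE mulrA x_y_prod ?index_enum_uniq ?mem_index_enum //.
rewrite mulrDl -mulrA (prod_commS _ (@weyl_xC K n)) ?index_enum_uniq ?mem_index_enum //.
rewrite -scalerAl; congr (_ * _ + _ *: (_ * _)); apply: eq_bigr => i _.
- by rewrite mnmDE mnm1E eq_rlshift add0n.
- by rewrite mnmDE mnm1E (inj_eq (@rshift_inj _ _)) addnC.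
- by rewrite mnmBE mnm1E (inj_eq (@lshift_inj _ _)).
by rewrite mnmBE mnm1E eq_lrshift subn0.
Qed.

Lemma weyl_coordK : cancel (@weyl_coord K n) weyl_of_coord.
Proof.
have ofc a p : weyl_of_coord (gact a p) = a * weyl_of_coord p.
  elim/weyl_ind: a p => [|i a IH|i a IH|c a b IHa IHb] p.
  - by rewrite act1 mul1r.
  - by rewrite actM act_x x_of_coord IH mulrA.
  - by rewrite actM act_y y_of_coord IH mulrA.
  by rewrite actD actZ linearP /= IHa IHb mulrDl scalerAl.
move=> a; rewrite /weyl_coord ofc -mpolyX0 weyl_of_coordX.
by rewrite /weyl_monomial big1 ?mulr1 // => i _; rewrite mnm0E expr0.
Qed.

(* See weyl_dy_monomial for the values on the basis. *)
Definition weyl_dy (l : 'I_n) (a : weyl) : weyl :=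
  weyl_of_coord (weyl_coord a)^`M(lshift n l).

Lemma weyl_dy_monomial l m : weyl_dy l (weyl_monomial m) =
  (m (lshift n l))%:R *: weyl_monomial (m - U_(lshift n l))%MM.
Proof.
by rewrite /weyl_dy weyl_coord_monomial mderivX linearZ /= weyl_of_coordX.
Qed.

Fact weyl_dy_linear l : linear (weyl_dy l).
Proof. by move=> c a b; rewrite /weyl_dy !linearP. Qed.

HB.instance Definition _ l :=
  GRing.isLinear.Build K weyl weyl _ (weyl_dy l) (weyl_dy_linear l).

End WeylMonomials.

Section MultiSeries.
Variable m : nat.

(* The multi-indices i <= d, componentwise. *)
Definition mbelow (d : 'X_{1..m}) : seq 'X_{1..m} :=
  [seq i <- [seq bmnm i | i : 'X_{1..m < (mdeg d).+1}] | (i <= d)%MM].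

Lemma mem_mbelow d i : (i \in mbelow d) = (i <= d)%MM.
Proof.
rewrite mem_filter; case: (boolP (i <= d)%MM) => //= le_id.
have lt_i : (mdeg i < (mdeg d).+1)%N.
  by rewrite ltnS -(submK le_id) mdegD leq_addl.
by apply/mapP; exists (BMultinom lt_i); rewrite // mem_enum.
Qed.

Lemma mbelow_uniq d : uniq (mbelow d).
Proof. by rewrite filter_uniq // map_inj_uniq ?enum_uniq //; exact: val_inj. Qed.

(* Formal power series in m commuting indeterminates with coefficients in V;
   f : mseries V m stands for the sum of the f d * t^d. *)
Definition mseries (V : Type) : Type := 'X_{1..m} -> V.

HB.instance Definition _ (V : Type) := gen_eqMixin (mseries V).
HB.instance Definition _ (V : Type) := gen_choiceMixin (mseries V).

Section Zmodule.
Variable V : zmodType.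
Implicit Types f g h : mseries V.

Definition ms_zero : mseries V := fun=> 0.
Definition ms_opp f : mseries V := fun d => - f d.
Definition ms_add f g : mseries V := fun d => f d + g d.

Fact ms_addA : associative ms_add.
Proof. by move=> f g h; apply/funext=> d; exact: addrA. Qed.
Fact ms_addC : commutative ms_add.
Proof. by move=> f g; apply/funext=> d; exact: addrC. Qed.
Fact ms_add0 : left_id ms_zero ms_add.
Proof. by move=> f; apply/funext=> d; exact: add0r. Qed.
Fact ms_addN : left_inverse ms_zero ms_opp ms_add.
Proof. by move=> f; apply/funext=> d; exact: addNr. Qed.

HB.instance Definition _ :=
  GRing.isZmodule.Build (mseries V) ms_addA ms_addC ms_add0 ms_addN.

Lemma msD f g d : (f + g) d = f d + g d. Proof. by []. Qed.
Lemma ms0 d : (0 : mseries V) d = 0. Proof. by []. Qed.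

End Zmodule.

(* The Cauchy product of f and g along op. *)
Definition ms_conv (U V W : zmodType) (op : U -> V -> W)
    (f : mseries U) (g : mseries V) : mseries W :=
  fun d => \sum_(j <- mbelow d) op (f j) (g (d - j)%MM).

Lemma ms_conv_triple (W : zmodType) (F : 'X_{1..m} -> 'X_{1..m} -> 'X_{1..m} -> W) d :
  \sum_(i <- mbelow d) \sum_(j <- mbelow i) F j (i - j)%MM (d - i)%MM =
  \sum_(i <- mbelow d) \sum_(j <- mbelow (d - i)%MM) F i j (d - i - j)%MM.
Proof.
pose G (p : 'X_{1..m} * 'X_{1..m}) := F p.1 p.2 (d - p.1 - p.2)%MM.
rewrite -[RHS](@big_allpairs_dep _ _ _ _ _ _ (fun i j : 'X_{1..m} => (i, j)) (mbelow d)
  (fun i => mbelow (d - i)%MM) G).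
rewrite (eq_big_seq (fun i => \sum_(j <- mbelow i) G (j, i - j)%MM)); last first.
  move=> i; rewrite mem_mbelow => /mnm_lepP le_id; apply: eq_big_seq => j.
  rewrite mem_mbelow => /mnm_lepP le_ji; rewrite /G /=; congr F.
  apply/mnmP=> l; rewrite !mnmBE; have := le_id l; have := le_ji l => ? ?.
  by rewrite -subnDA subnKC.
rewrite -(@big_allpairs_dep _ _ _ _ _ _ (fun i j : 'X_{1..m} => (j, i - j)%MM) (mbelow d)
  mbelow G).
apply/perm_big/uniq_perm.
- apply: allpairs_uniq_dep => [|i _|]; rewrite ?mbelow_uniq //.
  move=> [i j] [i' j'] /allpairsPdep[a [b [_ hb [-> ->]]]].
  move=> /allpairsPdep[a' [b' [_ hb' [-> ->]]]] /= e.
  have {}e : (b, a - b)%MM = (b', a' - b')%MM := e.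
  have eqb : b = b' := congr1 fst e; have := congr1 snd e; subst b' => /= eqa.
  rewrite !mem_mbelow in hb hb'.
  by have -> : a = a' by rewrite -(submK hb) eqa submK.
- apply: allpairs_uniq_dep => [|i _|]; rewrite ?mbelow_uniq //.
  by move=> [i j] [i' j'] _ _ /= [-> ->].
move=> [i j]; apply/allpairsPdep/allpairsPdep => -[a [b []]].
  rewrite !mem_mbelow => /mnm_lepP had /mnm_lepP hba [-> ->].
  exists b, (a - b)%MM; rewrite !mem_mbelow; split=> //.
    by apply/mnm_lepP => l; exact: leq_trans (hba l) (had l).
  by apply/mnm_lepP => l; rewrite !mnmBE leq_sub2r.
rewrite !mem_mbelow => /mnm_lepP had /mnm_lepP hba [-> ->].
exists (a + b)%MM, a; rewrite !mem_mbelow lem_addr; split=> //.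
  apply/mnm_lepP => l; have := hba l; rewrite mnmBE mnmDE => h.
  by rewrite -(subnKC (had l)) leq_add2l.
by rewrite addmC addmK.
Qed.

Lemma ms_conv_rev (W : zmodType) (F : 'X_{1..m} -> 'X_{1..m} -> W) d :
  \sum_(j <- mbelow d) F j (d - j)%MM = \sum_(j <- mbelow d) F (d - j)%MM j.
Proof.
have subK i : (i <= d)%MM -> (d - (d - i) = i)%MM.
  by move/mnm_lepP=> h; apply/mnmP=> l; rewrite !mnmBE subKn.
rewrite [RHS](perm_big [seq (d - i)%MM | i <- mbelow d]) /=; last first.
  apply: uniq_perm; rewrite ?mbelow_uniq //.
    rewrite map_inj_in_uniq ?mbelow_uniq // => i j.
    by rewrite !mem_mbelow => hi hj e; rewrite -(subK i) // e subK.
  move=> i; rewrite mem_mbelow; apply/idP/mapP => [hi|[j _ ->]].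
    by exists (d - i)%MM; rewrite ?mem_mbelow ?lem_subr ?subK.
  exact: lem_subr.
rewrite big_map; apply: eq_big_seq => i; rewrite mem_mbelow => hi.
by rewrite subK.
Qed.

Lemma ms_conv0 (W : zmodType) (F : 'X_{1..m} -> W) d :
  (forall i, i != 0%MM -> F i = 0) -> \sum_(i <- mbelow d) F i = F 0%MM.
Proof.
have d0 : 0%MM \in mbelow d.
  by rewrite mem_mbelow; apply/mnm_lepP => l; rewrite mnm0E.
move=> F0; rewrite (bigD1_seq 0%MM) ?mbelow_uniq //=.
by rewrite big1 ?addr0.
Qed.

Section Ring.
Variable R : comPzRingType.

Definition ms_one : mseries R := fun d => (d == 0%MM)%:R.
Definition ms_mul : mseries R -> mseries R -> mseries R := ms_conv *%R.

Section Module.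
Variable V : lmodType R.

Definition ms_scale : mseries R -> mseries V -> mseries V := ms_conv *:%R.

Fact ms_scaleA f g u : ms_scale f (ms_scale g u) = ms_scale (ms_mul f g) u.
Proof.
apply/funext=> d; rewrite /ms_scale /ms_mul /ms_conv.
rewrite [RHS](eq_bigr (fun i => \sum_(j <- mbelow i)
  (f j * g (i - j)%MM) *: u (d - i)%MM)); last by move=> i _; rewrite scaler_suml.
rewrite (ms_conv_triple (fun i j k => (f i * g j) *: u k)).
apply: eq_bigr => i _; rewrite scaler_sumr.
by apply: eq_bigr => j _; rewrite scalerA.
Qed.

Fact ms_scale1 : left_id ms_one ms_scale.
Proof.
move=> u; apply/funext=> d; rewrite /ms_scale /ms_conv /ms_one.
rewrite (ms_conv0 (F := fun i => _ *: u (d - i)%MM)) ?eqxx ?scale1r ?subm0 //.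
by move=> i /negPf->; rewrite scale0r.
Qed.

Fact ms_scale0 u : ms_scale 0 u = 0.
Proof.
apply/funext=> d; rewrite /ms_scale /ms_conv big1 // => i _.
by rewrite ms0 scale0r.
Qed.

Fact ms_scaleDr : right_distributive ms_scale +%R.
Proof.
move=> f u v; apply/funext=> d; rewrite msD -big_split /=.
by apply: eq_bigr => i _; rewrite msD scalerDr.
Qed.

Fact ms_scaleDl u : {morph ms_scale^~ u : f g / f + g}.
Proof.
move=> f g; apply/funext=> d; rewrite msD -big_split /=.
by apply: eq_bigr => i _; rewrite msD scalerDl.
Qed.

End Module.

Fact ms_mulA : associative ms_mul.
Proof. by move=> f g h; exact: (@ms_scaleA R^o). Qed.

Fact ms_mulC : commutative ms_mul.
Proof.
move=> f g; apply/funext=> d.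
rewrite [LHS](ms_conv_rev (fun i j => f i * g j)).
by apply: eq_bigr => i _; rewrite mulrC.
Qed.

Fact ms_mul1 : left_id ms_one ms_mul.
Proof. exact: (@ms_scale1 R^o). Qed.

Fact ms_mulDl : left_distributive ms_mul +%R.
Proof. by move=> f g h; exact: (@ms_scaleDl R^o). Qed.

HB.instance Definition _ := GRing.Zmodule_isComPzRing.Build (mseries R)
  ms_mulA ms_mulC ms_mul1 ms_mulDl.

End Ring.

HB.instance Definition _ (R : comPzRingType) (V : lmodType R) :=
  GRing.Nmodule_isLSemiModule.Build (mseries R) (mseries V)
    (@ms_scaleA R V) (@ms_scale0 R V) (@ms_scale1 R V) (@ms_scaleDr R V)
    (@ms_scaleDl R V).

End MultiSeries.

Definition bilinear_map (R : comPzRingType) (L : lmodType R) (br : L -> L -> L) :=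
  (forall b, linear (br^~ b)) /\ (forall a, linear (br a)).

Record hom_lie_algebra (R : comPzRingType) (L : lmodType R)
    (br : L -> L -> L) (al : L -> L) : Prop := HomLieAlgebra {
  hom_lie_bilinear : bilinear_map br;
  hom_lie_linear : linear al;
  hom_lie_alternating : forall a, br a a = 0;
  hom_lie_jacobi : forall a b c,
    br (al a) (br b c) + br (al c) (br a b) + br (al b) (br c a) = 0
}.

Section Deformation.
Variables (R : comPzRingType) (L : lmodType R) (m : nat).
Local Notation "L [[t]]" := (mseries m L) (at level 2).

Definition hom_ext2 (br : L -> L -> L) (f g : L[[t]]) : L[[t]] := ms_conv br f g.
Definition hom_ext (al : L -> L) (f : L[[t]]) : L[[t]] := fun d => al (f d).

(* The coefficient of t^d in the formal sum of the F i * t^i is the finite sum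
   of the coefficients of t^(d - i) in F i, for i <= d. *)
Definition formal_sum (F : 'X_{1..m} -> L[[t]]) : L[[t]] :=
  fun d => \sum_(i <- mbelow d) F i (d - i)%MM.

Definition deformed_bracket (br_ : 'X_{1..m} -> L -> L -> L) (f g : L[[t]]) :=
  formal_sum (fun i => hom_ext2 (br_ i) f g).
Definition deformed_twist (al_ : 'X_{1..m} -> L -> L) (f : L[[t]]) :=
  formal_sum (fun i => hom_ext (al_ i) f).

Record formal_hom_lie_deformation (br : L -> L -> L) (al : L -> L)
    (br_ : 'X_{1..m} -> L -> L -> L) (al_ : 'X_{1..m} -> L -> L) : Prop :=
  FormalHomLieDeformation {
    deform_hom_lie : hom_lie_algebra br al;
    deform_bilinear : forall i, bilinear_map (br_ i);
    deform_linear : forall i, linear (al_ i);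
    deform_bracket0 : forall a b, br_ 0%MM a b = br a b;
    deform_twist0 : forall a, al_ 0%MM a = al a;
    deform_hom_lie_series : @hom_lie_algebra (mseries m R) (mseries m L)
      (deformed_bracket br_) (deformed_twist al_)
  }.
End Deformation.

Section WeylDeformation.
Variables (K : fieldType) (n m : nat) (ell : 'I_m -> 'I_n).
Local Notation weyl := (weyl K n).

Definition weyl_bracket (a b : weyl) : weyl := a * b - b * a.

Definition weyl_hom_bracket (k : 'I_n -> K) (a b : weyl) : weyl :=
  weyl_hom_mul k a b - weyl_hom_mul k b a.

Definition deform_alpha (i : 'X_{1..m}) (a : weyl) : weyl :=
  ((\prod_(s < m) (i s)`!)%:R)^-1 *:
  (\big[(fun f g => f \o g)/id]_(s < m) iter (i s) (@weyl_dy K n (ell s))) a.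

Definition deform_bracket (i : 'X_{1..m}) (a b : weyl) : weyl :=
  deform_alpha i (a * b - b * a).

Definition param_power (k : 'I_n -> K) (i : 'X_{1..m}) : K :=
  \prod_(s < m) k (ell s) ^+ i s.

End WeylDeformation.

Definition has_finite_sum (I : choiceType) (V : zmodType) (F : I -> V) (v : V) :=
  finite_set [set i | F i != 0]%classic /\ \sum_(i \in [set: I]%classic) F i = v.

(* Main.v *)
(* Since [x_l, _] is a derivation, the operators alpha_i satisfy the iterated
   Leibniz rule alpha_i (a b) = sum of the alpha_j a * alpha_(i - j) b over
   j <= i, so that the twisting map T = sum of the alpha_i t^i is multiplicative
   on the power series over A_n. The deformed bracket is [f, g] followed by T,
   where [f, g] is the commutator of power series, and a Lie bracket followed by
   one of its endomorphisms is a hom-Lie bracket. Evaluating t at k turns T into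
   an algebra morphism that agrees with the shift on the generators. *)
Require Import Defs.
From mathcomp Require Import all_boot all_order all_algebra.
From mathcomp Require Import boolp classical_sets cardinality fsbigop.
From mathcomp Require Import mpoly.

Import GRing.Theory.
Local Open Scope ring_scope.

Set Implicit Arguments.
Unset Strict Implicit.
Unset Printing Implicit Defensive.

(* Versions of raddfB, raddf0, etc. for linearity given as a hypothesis. *)
Section LinearProperty.
Variables (R : pzRingType) (U V : lmodType R) (f : U -> V).
Hypothesis fL : linear f.

Lemma linear_propB a b : f (a - b) = f a - f b.
Proof. by rewrite addrC -scaleN1r fL scaleN1r addrC. Qed.

Lemma linear_prop0 : f 0 = 0.
Proof. by rewrite -(subrr 0) linear_propB !subrr. Qed.

Lemma linear_propD a b : f (a + b) = f a + f b.
Proof. by rewrite -[a]scale1r fL !scale1r. Qed.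

Lemma linear_propZ c a : f (c *: a) = c *: f a.
Proof. by rewrite -[c *: a]addr0 fL linear_prop0 addr0. Qed.

Lemma linear_prop_sum (I : Type) (r : seq I) (P : pred I) (F : I -> U) :
  f (\sum_(i <- r | P i) F i) = \sum_(i <- r | P i) f (F i).
Proof. exact: (big_morph f linear_propD linear_prop0). Qed.

End LinearProperty.

Lemma linear_sub (R : pzRingType) (U V : lmodType R) (f g : U -> V) :
  linear f -> linear g -> linear (fun a => f a - g a).
Proof. by move=> fL gL c a b; rewrite fL gL scalerBr opprD addrACA. Qed.

(** * Hom-Lie brackets from commutators and from twisting by an endomorphism *)

Section HomLie.
Variables (R : comPzRingType) (L : lmodType R).

(** The product is a bare function so that [ms_conv] qualifies as well: power series over [weyl]
    carry only a module structure here. *)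
Lemma commutator_lie (mul : L -> L -> L) :
    bilinear_map mul -> associative mul ->
  hom_lie_algebra (fun a b => mul a b - mul b a) id.
Proof.
move=> [mulLl mulLr] mulA; split=> //.
- by split=> b; apply: linear_sub.
- by move=> a; rewrite subrr.
(* Each parenthesis collects two products with the same middle factor. With S_b = abc + cba this
   reads [a,[b,c]] = S_b - S_c, and the cyclic sum telescopes. *)
have jac a b c : mul a (mul b c - mul c b) - mul (mul b c - mul c b) a =
    (mul (mul a b) c + mul (mul c b) a) - (mul (mul a c) b + mul (mul b c) a).
  rewrite (linear_propB (mulLl a)) (linear_propB (mulLr a)) !mulA.
  by rewrite opprB addrACA [- _ - _]addrC opprD [- mul _ _ - _]addrC.
move=> a b c; rewrite !jac.
rewrite [mul (mul c b) a + mul (mul a b) c]addrC.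
rewrite [mul (mul b c) a + mul (mul a c) b]addrC.
rewrite [mul (mul b a) c + mul (mul c a) b]addrC.
by rewrite [X in X + _]addrC [X in X + _]addrA subrK addrA subrK subrr.
Qed.

(** As [al] is an endomorphism of [br], the hom-Jacobi sum of the new bracket is the image of the
    Jacobi sum of [br] under [al \o al]. *)
Lemma hom_lie_twist (br : L -> L -> L) (al : L -> L) :
    hom_lie_algebra br id -> linear al -> {morph al : a b / br a b} ->
  hom_lie_algebra (fun a b => al (br a b)) al.
Proof.
move=> [[brLl brLr] _ brr jac] alL alM.
split=> [|//|a|a b c].
- by split=> [b|a] c u v; rewrite (brLl, brLr) alL.
- by rewrite brr linear_prop0.
by rewrite -!alM -!(linear_propD alL) jac !(linear_prop0 alL).
Qed.

End HomLie.

(** * Convolution of power series and the deformed twist *)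

Section Convolution.
Variable m : nat.
Local Notation mnom := 'X_{1..m}.

(** Both sides run over the triples with sum [d]. Grouped by the sum of the first two indices, the
    exchange is a reversal of the inner sum. *)
Lemma ms_conv_swap (W : zmodType) (F : mnom -> mnom -> mnom -> W) d :
  \sum_(i <- mbelow d) \sum_(j <- mbelow (d - i)%MM) F i j (d - i - j)%MM =
  \sum_(i <- mbelow d) \sum_(j <- mbelow (d - i)%MM) F j i (d - i - j)%MM.
Proof.
rewrite -(ms_conv_triple F) -(ms_conv_triple (fun i j l => F j i l)).
apply: eq_bigr => i _; rewrite (ms_conv_rev (fun j l => F j l (d - i)%MM)) //.
Qed.

Variables (R : comPzRingType) (L : lmodType R).

Lemma msZ (c : mseries m R) (f : mseries m L) d :
  (c *: f) d = \sum_(i <- mbelow d) c i *: f (d - i)%MM.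
Proof. by []. Qed.

Section Bilinear.
Variable op : L -> L -> L.
Hypothesis opL : bilinear_map op.

Lemma ms_conv_bilinear :
  @bilinear_map (mseries m R) (mseries m L) (@ms_conv m L L L op).
Proof.
split=> [g c f h|f c g h]; apply/funext=> d; rewrite msD msZ /ms_conv.
  under eq_bigr => i _ do rewrite msD (linear_propD (opL.1 _)) msZ (linear_prop_sum (opL.1 _)).
  rewrite big_split; congr (_ + _).
  under [RHS]eq_bigr => i _ do rewrite scaler_sumr.
  rewrite (ms_conv_triple (fun i j l => op (c i *: f j) (g l))).
  by apply: eq_bigr => i _; apply: eq_bigr => j _; rewrite (linear_propZ (opL.1 _)).
under eq_bigr => i _ do rewrite msD (linear_propD (opL.2 _)) msZ (linear_prop_sum (opL.2 _)).
rewrite big_split; congr (_ + _).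
under [RHS]eq_bigr => i _ do rewrite scaler_sumr.
rewrite (ms_conv_swap (fun i j l => op (f i) (c j *: g l))).
by apply: eq_bigr => i _; apply: eq_bigr => j _; rewrite (linear_propZ (opL.2 _)).
Qed.

Lemma ms_conv_assoc : associative op -> associative (@ms_conv m L L L op).
Proof.
move=> opA f g h; apply/funext=> d; rewrite /ms_conv.
under [RHS]eq_bigr => i _ do rewrite (linear_prop_sum (opL.1 _)).
rewrite (ms_conv_triple (fun i j l => op (op (f i) (g j)) (h l))).
apply: eq_bigr => i _; rewrite (linear_prop_sum (opL.2 _)).
by apply: eq_bigr => j _; rewrite opA.
Qed.

Lemma ms_conv_commutator (f g : mseries m L) :
  ms_conv (fun a b => op a b - op b a) f g = ms_conv op f g - ms_conv op g f.
Proof.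
apply/funext=> d; rewrite /ms_conv sumrB; congr (_ - _).
by rewrite (ms_conv_rev (fun i j => op (g j) (f i))).
Qed.

Section HigherDerivation.
Variable al : mnom -> L -> L.
Hypothesis alL : forall i, linear (al i).

Lemma deformed_twistE (f : mseries m L) d :
  deformed_twist al f d = \sum_(i <- mbelow d) al i (f (d - i)%MM).
Proof. by []. Qed.

Lemma deformed_twist_linear :
  GRing.linear_for ( *:%R : mseries m R -> mseries m L -> mseries m L)
    (deformed_twist al).
Proof.
move=> c f g; apply/funext=> d; rewrite msD msZ !deformed_twistE.
under eq_bigr => i _ do rewrite msD (linear_propD (alL _)) msZ (linear_prop_sum (alL _)).
rewrite big_split; congr (_ + _).
under [RHS]eq_bigr => i _ do rewrite deformed_twistE scaler_sumr.
rewrite (ms_conv_swap (fun i j l => al i (c j *: f l))).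
by apply: eq_bigr => i _; apply: eq_bigr => j _; rewrite (linear_propZ (alL _)).
Qed.

(** Additivity moves each [al i] out of the convolution sum; this gives the deformed bracket the
    form treated by [hom_lie_twist]. *)
Lemma deformed_bracket_twist (f g : mseries m L) :
  deformed_bracket (fun i a b => al i (op a b)) f g =
  deformed_twist al (ms_conv op f g).
Proof.
apply/funext=> d; rewrite deformed_twistE /deformed_bracket /formal_sum.
by apply: eq_bigr => i _; rewrite (linear_prop_sum (alL _)).
Qed.

Lemma deformed_twist_morph :
    (forall i a b,
      al i (op a b) = \sum_(j <- mbelow i) op (al j a) (al (i - j)%MM b)) ->
  {morph deformed_twist al : f g / ms_conv op f g}.
Proof.
move=> leib f g; apply/funext=> d; rewrite deformed_twistE [RHS]/ms_conv.
under [RHS]eq_bigr => i _ do rewrite deformed_twistE (linear_prop_sum (opL.1 _)).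
rewrite (ms_conv_triple (fun i j l => op (al i (f j)) (deformed_twist al g l))).
(* The Leibniz rule turns the coefficient into a sum over [p + q + j + l = d], grouped here by
   [i = p + q]. *)
transitivity (\sum_(i <- mbelow d) \sum_(p <- mbelow i)
    \sum_(j <- mbelow (d - i)%MM) op (al p (f j)) (al (i - p)%MM (g (d - i - j)%MM))).
  apply: eq_bigr => i _; rewrite exchange_big (linear_prop_sum (alL _)).
  by apply: eq_bigr => j _; rewrite leib.
rewrite (ms_conv_triple (fun p q y =>
  \sum_(j <- mbelow y) op (al p (f j)) (al q (g (y - j)%MM)))).
apply: eq_bigr => p _.
(* With [q] and [j] exchanged, the inner sum over [q] is a coefficient of the twist of [g]. *)
rewrite (ms_conv_swap (fun q j l => op (al p (f j)) (al q (g l)))).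
by apply: eq_bigr => q _; rewrite deformed_twistE (linear_prop_sum (opL.2 _)).
Qed.

End HigherDerivation.
End Bilinear.
End Convolution.

(** * Commutators with a fixed element *)

Section Commutator.
Variable A : pzRingType.
Implicit Types x y a b : A.

Lemma commutatorM x a b :
  x * (a * b) - a * b * x = (x * a - a * x) * b + a * (x * b - b * x).
Proof. by rewrite mulrBl mulrBr !mulrA subrKA. Qed.

(** This is the Jacobi identity with [x, y] = 0. *)
Lemma commutator_comm x y a : x * y = y * x ->
  x * (y * a - a * y) - (y * a - a * y) * x =
  y * (x * a - a * x) - (x * a - a * x) * y.
Proof.
move=> xy; rewrite !mulrBr !mulrBl !opprB !mulrA xy -!(mulrA a) xy !mulrA.
by rewrite addrACA [- _ - _]addrC -addrACA.
Qed.

End Commutator.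

(** * Partial derivatives as inner derivations of the Weyl algebra *)

Section WeylDerivation.
Variables (K : fieldType) (n : nat).
Local Notation weyl := (weyl K n).
Implicit Types a b : weyl.

Lemma weyl_coord_x i a :
  weyl_coord (weyl_x K i * a) = coord_op (inl i) (weyl_coord a).
Proof.
apply: (can_inj (@weyl_of_coordK K n)).
by rewrite x_of_coord !weyl_coordK.
Qed.

Lemma weyl_coord_y i a :
  weyl_coord (weyl_y K i * a) = coord_op (inr i) (weyl_coord a).
Proof.
apply: (can_inj (@weyl_of_coordK K n)).
by rewrite y_of_coord !weyl_coordK.
Qed.

Lemma weyl_dy1 l : weyl_dy l (1 : weyl) = 0.
Proof.
have <- : weyl_monomial K (0 : 'X_{1..n + n})%MM = 1.
  by rewrite /weyl_monomial big1 // => i _; rewrite mnm0E expr0.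
by rewrite weyl_dy_monomial mnm0E scale0r.
Qed.

Lemma weyl_dy_xM l i a : weyl_dy l (weyl_x K i * a) = weyl_x K i * weyl_dy l a.
Proof.
rewrite /weyl_dy weyl_coord_x -x_of_coord /=; congr weyl_of_coord.
by rewrite mderivD mderivM mderiv_U eq_lrshift mul0r add0r mderiv_comm.
Qed.

Lemma weyl_dy_yM l i a : weyl_dy l (weyl_y K i * a) =
  weyl_y K i * weyl_dy l a + (l == i)%:R *: a.
Proof.
rewrite /weyl_dy weyl_coord_y -y_of_coord /=.
rewrite mderivM mderiv_U (inj_eq (@lshift_inj _ _)) addrC linearD /=.
by rewrite mulr_natl -scaler_nat linearZ /= weyl_coordK.
Qed.

(** Both sides kill 1 and obey the same rules under left multiplication by generators. The
    commutator form yields the Leibniz rule and the commutation of the derivatives, which the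
    ordered basis does not show directly. *)
Lemma weyl_dyE l a : weyl_dy l a = weyl_x K l * a - a * weyl_x K l.
Proof.
elim/weyl_ind: a => [|i a IH|i a IH|c a b IHa IHb].
- by rewrite weyl_dy1 mulr1 mul1r subrr.
- by rewrite weyl_dy_xM IH mulrBr !mulrA weyl_xC.
- rewrite weyl_dy_yM IH commutatorM weyl_xyC addrAC subrr add0r addrC.
  by rewrite scaler_nat mulr_natl.
rewrite linearP /= IHa IHb mulrDr mulrDl scalerBr scalerAr scalerAl.
by rewrite opprD addrACA.
Qed.

Lemma weyl_dyM l a b : weyl_dy l (a * b) = weyl_dy l a * b + a * weyl_dy l b.
Proof. by rewrite !weyl_dyE commutatorM. Qed.

Lemma weyl_dyC l l' a : weyl_dy l (weyl_dy l' a) = weyl_dy l' (weyl_dy l a).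
Proof. by rewrite !weyl_dyE; exact/commutator_comm/weyl_xC. Qed.

Lemma weyl_dy_x l i : weyl_dy l (weyl_x K i : weyl) = 0.
Proof. by rewrite weyl_dyE weyl_xC subrr. Qed.

Lemma weyl_dy_y l i : weyl_dy l (weyl_y K i : weyl) = (l == i)%:R *: (1 : weyl).
Proof. by rewrite -[weyl_y K i]mulr1 weyl_dy_yM weyl_dy1 mulr0 add0r. Qed.

End WeylDerivation.

(** * Induction on multi-indices and sums over lower indices *)

Section MultiIndex.
Variable m : nat.
Implicit Types i j d : 'X_{1..m}.

(** Induction on the total degree: a nonzero index has a positive entry, which can be lowered. *)
Lemma mnm_add1_ind (P : 'X_{1..m} -> Prop) :
    P 0%MM -> (forall i s, P i -> P (i + U_(s))%MM) -> forall i, P i.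
Proof.
move=> P0 PS i; have [e] := ubnP (mdeg i); elim: e i => // e IH i lt_ie.
have [->|] := eqVneq i 0%MM; first by [].
rewrite -mdeg_eq0 mdegE sum_nat_eq0 negb_forall => /existsP[s] /= is0.
have le_si : (U_(s) <= i)%MM by rewrite lep1mP.
move: lt_ie; rewrite -(submK le_si) mdegD mdeg1 addn1 ltnS => lt_ie.
by apply: PS; exact: IH.
Qed.

Lemma mnm1_inj : injective (fun s : 'I_m => U_(s)%MM).
Proof.
move=> s t /= /mnmP/(_ s); rewrite !mnm1E eqxx.
by case: eqVneq.
Qed.

Lemma sum_mbelow0 (V : nmodType) (F : 'X_{1..m} -> V) :
  \sum_(j <- mbelow 0) F j = F 0%MM.
Proof.
transitivity (\sum_(j <- [:: 0%MM]) F j); last by rewrite big_seq1.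
apply/perm_big/uniq_perm; rewrite ?mbelow_uniq //.
move=> j; rewrite mem_mbelow inE; apply/mnm_lepP/eqP => [j0|->] //.
by apply/mnmP=> t; apply/eqP; have := j0 t; rewrite mnm0E leqn0.
Qed.

(** Translation by [U_(s)] maps the indices below [d] onto those below [d + U_(s)] with positive
    entry at [s]. It serves for summands with a factor [j s]. *)
Lemma sum_mbelow_add1 (V : nmodType) (F : 'X_{1..m} -> V) d s :
    (forall j, j s = 0%N -> F j = 0) ->
  \sum_(j <- mbelow (d + U_(s))%MM) F j = \sum_(j <- mbelow d) F (j + U_(s))%MM.
Proof.
move=> F0; rewrite (bigID (fun j : 'X_{1..m} => j s == 0%N)) /= big1 ?add0r; last first.
  by move=> j /eqP; exact: F0.
rewrite -(big_map (fun j => (j + U_(s))%MM) xpredT F) -big_filter.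
apply/perm_big/uniq_perm.
- by rewrite filter_uniq ?mbelow_uniq.
- by rewrite map_inj_uniq ?mbelow_uniq //; exact: (can_inj (addmK _)).
move=> j; rewrite mem_filter mem_mbelow; apply/andP/mapP => [[js0 le_jd]|[i]].
  have le_sj : (U_(s) <= j)%MM by rewrite lep1mP.
  exists (j - U_(s))%MM; last by rewrite submK.
  rewrite mem_mbelow; apply/mnm_lepP=> t; have := mnm_lepP le_jd t.
  by rewrite mnmDE mnmBE leq_subLR addnC.
rewrite mem_mbelow => le_id ->; rewrite mnmDE mnm1E eqxx addn1; split=> //.
apply/mnm_lepP=> t; rewrite !mnmDE leq_add2r; exact: mnm_lepP.
Qed.

End MultiIndex.

(** * Composites of commuting iterates *)

Section ComposedIterates.
Variables (I : eqType) (T : Type) (f : I -> T -> T).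

(** The exponent changes in the single factor of [s], and the additional [f s] passes to the front
    through the factors before it. *)
Lemma comp_iter_add1 (r : seq I) (e e' : I -> nat) s :
    (forall t u a, f t (f u a) = f u (f t a)) -> uniq r -> s \in r ->
    (forall t, e' t = (e t + (s == t))%N) ->
  (\big[(fun g h => g \o h)/id]_(t <- r) iter (e' t) (f t)) =1
  f s \o \big[(fun g h => g \o h)/id]_(t <- r) iter (e t) (f t).
Proof.
move=> fC ur sr e'E a /=.
have iterC u t p b : f u (iter p (f t) b) = iter p (f t) (f u b).
  by elim: p => //= p IH; rewrite fC IH.
elim: r ur sr => //= t r IH /andP[tr ur]; rewrite inE !big_cons /= e'E.
have [eq_st _|ne sr] := eqVneq s t; last by rewrite addn0 IH // iterC.
subst t; rewrite addn1 iterS; congr (f s (iter _ _ _)).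
move: tr; elim: r {IH ur} => [|u r IH]; first by rewrite !big_nil.
rewrite inE negb_or !big_cons e'E /= => /andP[/negPf ne tr].
by rewrite ne addn0 IH.
Qed.

End ComposedIterates.

(** * The operators alpha_i and the iterated Leibniz rule *)

Section DeformAlpha.
Variables (K : fieldType) (charK0 : [pchar K] =i pred0).
Variables (n m : nat) (ell : 'I_m -> 'I_n).
Local Notation weyl := (weyl K n).
Local Notation alpha := (@deform_alpha K n m ell).
Implicit Types (a b : weyl) (i j : 'X_{1..m}).

Let natK_neq0 p : p.+1%:R != 0 :> K.
Proof. by move/pcharf0P: charK0 => ->. Qed.

Lemma deform_alpha_linear i : linear (alpha i).
Proof.
have iterL p l : linear (iter p (@weyl_dy K n l)).
  by move=> c a b; elim: p => //= p ->; rewrite linearP.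
rewrite /deform_alpha => c a b.
have -> : forall r : seq 'I_m,
    linear (\big[(fun f g => f \o g)/id]_(s <- r) iter (i s) (@weyl_dy K n (ell s))).
  elim=> [|s r IH] c' a' b'; first by rewrite big_nil.
  by rewrite big_cons /= IH iterL.
by rewrite scalerDr !scalerA mulrC.
Qed.

Lemma deform_alpha0 a : alpha 0%MM a = a.
Proof.
rewrite /deform_alpha big1 ?invr1 ?scale1r; last by move=> s _; rewrite mnm0E.
elim: (index_enum _) => [|s r IH]; first by rewrite big_nil.
by rewrite big_cons /= mnm0E.
Qed.

(** Follows from (p + 1)! = (p + 1) p!. In characteristic zero this recursion and [deform_alpha0]
    determine every alpha_i; they replace the explicit formula from here on. *)
Lemma deform_alpha_add1 i s a :
  (i s).+1%:R *: alpha (i + U_(s))%MM a = weyl_dy (ell s) (alpha i a).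
Proof.
rewrite /deform_alpha [RHS]linearZ /= scalerA.
have dyC t u (b : weyl) : weyl_dy (ell t) (weyl_dy (ell u) b) =
  weyl_dy (ell u) (weyl_dy (ell t) b) by exact: weyl_dyC.
have addE t : (i + U_(s))%MM t = (i t + (s == t))%N by rewrite mnmDE mnm1E.
rewrite (comp_iter_add1 dyC _ _ addE) ?index_enum_uniq ?mem_index_enum //=.
congr (_ *: _); rewrite (bigD1 s) //= [in RHS](bigD1 s) //=.
rewrite mnmDE mnm1E eqxx addn1 factS.
rewrite (eq_bigr (fun t => (i t)`!)); last first.
  by move=> t ts; rewrite mnmDE mnm1E eq_sym (negPf ts) addn0.
rewrite -mulnA [in LHS]natrM invfM.
by rewrite mulrA mulfV ?mul1r.
Qed.

Lemma deform_alpha_dy0 i a : (forall s, weyl_dy (ell s) a = 0) -> i != 0%MM -> alpha i a = 0.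
Proof.
move=> a0; elim/mnm_add1_ind: i => [|i s IH _]; first by rewrite eqxx.
apply: (scalerI (natK_neq0 (i s))); rewrite deform_alpha_add1 scaler0.
by have [->|/IH->] := eqVneq i 0%MM; rewrite ?deform_alpha0 ?a0 ?linear0.
Qed.

Lemma deform_alphaM i a b :
  alpha i (a * b) = \sum_(j <- mbelow i) alpha j a * alpha (i - j)%MM b.
Proof.
elim/mnm_add1_ind: i => [|i s IH].
  by rewrite sum_mbelow0 subm0 !deform_alpha0.
apply: (scalerI (natK_neq0 (i s))); rewrite deform_alpha_add1 IH linear_sum.
rewrite scaler_sumr.
(* For [j + j' = i + U_(s)] the coefficient [(i s).+1] splits as [j s + j' s]. By the recursion, the
   part [F] becomes the derivative of the left factor and [G] that of the right one. *)
pose F j j' := (j s)%:R *: alpha j a * alpha j' b.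
pose G j j' := alpha j a * ((j' s)%:R *: alpha j' b).
rewrite [RHS](eq_big_seq (fun j => F j (i + U_(s) - j)%MM + G j (i + U_(s) - j)%MM)).
  rewrite big_split (ms_conv_rev G) !sum_mbelow_add1; last first.
  - by move=> j js0; rewrite /F js0 scale0r mul0r.
  - by move=> j js0; rewrite /G js0 scale0r mulr0.
  have addUK j : (i + U_(s) - (j + U_(s)))%MM = (i - j)%MM.
    by apply/mnmP=> t; rewrite !(mnmBE, mnmDE) subnDr.
  under [X in _ = _ + X]eq_bigr => j _ do rewrite addUK.
  (* The second reversal leaves the raised index on the right factor. *)
  rewrite -(ms_conv_rev (fun j j' => G j (j' + U_(s))%MM)) -big_split.
  apply: eq_bigr => j _; rewrite addUK /F /G !mnmDE !mnm1E eqxx !addn1.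
  by rewrite !deform_alpha_add1 /= weyl_dyM.
move=> j; rewrite mem_mbelow => /mnm_lepP/(_ s) le_js.
rewrite /F /G; move: (alpha j a) (alpha _ b) => u v.
rewrite -scalerAl -scalerAr -scalerDl -natrD mnmBE subnKC //.
by rewrite mnmDE mnm1E eqxx addn1.
Qed.

End DeformAlpha.

(** * Sums of finite support and their Cauchy product *)

Section FiniteSum.
Variables (I : choiceType) (V : zmodType).
Implicit Types (F G : I -> V) (v w : V).

Lemma fsbig_setT_seq F (r : seq I) : uniq r -> (forall i, i \notin r -> F i = 0) ->
  \sum_(i \in [set: I]%classic) F i = \sum_(i <- r) F i.
Proof.
move=> ur F0; rewrite (fsbigE r) // => [|i _]; last exact: F0.
by apply: eq_bigl => i; rewrite in_setT.
Qed.

(** The list may contain indices of zero terms, so two families can be summed over a common list. *)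
Lemma has_finite_sumP F v : has_finite_sum F v <->
  exists r : seq I, [/\ uniq r, forall i, i \notin r -> F i = 0 & \sum_(i <- r) F i = v].
Proof.
split=> [[finF <-]|[r [ur F0 <-]]].
  have /finite_seqP[r rE] := finF.
  have F0 i : i \notin undup r -> F i = 0.
    rewrite mem_undup => ir; apply/eqP; apply: contraNT ir => Fi.
    suff: [set` r]%classic i by [].
    by rewrite -rE.
  exists (undup r); split; rewrite ?undup_uniq //.
  by rewrite -fsbig_setT_seq ?undup_uniq.
split; last by rewrite (fsbig_setT_seq ur).
apply: sub_finite_set (finite_seq r) => i /= Fi.
by apply: contraNT Fi => /F0->.
Qed.

Lemma has_finite_sum_single F i : (forall j, j != i -> F j = 0) ->
  has_finite_sum F (F i).
Proof.
move=> F0; apply/has_finite_sumP; exists [:: i].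
by split=> // [j|]; rewrite ?big_seq1 // inE; exact: F0.
Qed.

Lemma has_finite_sum_sub F v (r : seq I) : has_finite_sum F v -> uniq r ->
  (forall i, i \notin r -> F i = 0) -> \sum_(i <- r) F i = v.
Proof.
by move=> [_ <-] ur F0; rewrite -fsbig_setT_seq.
Qed.

Lemma has_finite_sumD F G v w : has_finite_sum F v -> has_finite_sum G w ->
  has_finite_sum (fun i => F i + G i) (v + w).
Proof.
move=> Fv Gw; apply/has_finite_sumP.
have /has_finite_sumP[r [_ F0 _]] := Fv.
have /has_finite_sumP[r' [_ G0 _]] := Gw.
exists (undup (r ++ r')).
have F0' i : i \notin undup (r ++ r') -> F i = 0.
  by rewrite mem_undup mem_cat negb_or => /andP[/F0].
have G0' i : i \notin undup (r ++ r') -> G i = 0.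
  by rewrite mem_undup mem_cat negb_or => /andP[_ /G0].
split=> [|i ir|]; rewrite ?undup_uniq ?F0' ?G0' ?addr0 // big_split.
by congr (_ + _); apply: has_finite_sum_sub; rewrite ?undup_uniq.
Qed.

End FiniteSum.

Lemma has_finite_sum_additive (I : choiceType) (V W : zmodType) (f : {additive V -> W})
    (F : I -> V) v :
  has_finite_sum F v -> has_finite_sum (f \o F) (f v).
Proof.
move=> /has_finite_sumP[r [ur F0 <-]]; apply/has_finite_sumP; exists r.
by split=> // [i /F0 /= ->|]; rewrite ?raddf0 ?raddf_sum.
Qed.

Lemma has_finite_sum_conv (m : nat) (A : pzRingType) (F G : 'X_{1..m} -> A) v w :
    has_finite_sum F v -> has_finite_sum G w ->
  has_finite_sum (fun i => \sum_(j <- mbelow i) F j * G (i - j)%MM) (v * w).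
Proof.
move=> Fv Gw; apply/has_finite_sumP.
have /has_finite_sumP[r [ur F0 Fr]] := Fv.
have /has_finite_sumP[r' [_ G0 _]] := Gw.
(* A nonzero product [F j * G l] contributes at [j + l], so these sums cover the support of the
   convolution. *)
pose r2 := undup [seq (j + l)%MM | j <- r, l <- r'].
have sum_r i : \sum_(j <- mbelow i) F j * G (i - j)%MM =
    \sum_(j <- r | (j <= i)%MM) F j * G (i - j)%MM.
  rewrite (bigID (mem r)) /= [X in _ + X]big1 ?addr0; last first.
    by move=> j /F0->; rewrite mul0r.
  rewrite -big_filter -[RHS]big_filter; apply/perm_big/uniq_perm.
  - by rewrite filter_uniq ?mbelow_uniq.
  - by rewrite filter_uniq.
  by move=> j; rewrite [LHS]mem_filter [RHS]mem_filter mem_mbelow andbC.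
have mem_r2 j l : F j != 0 -> G l != 0 -> (j + l)%MM \in r2.
  move=> Fj Gl; rewrite mem_undup; apply: allpairs_f.
    by apply: contraNT Fj => /F0->.
  by apply: contraNT Gl => /G0->.
exists r2; split=> [|i ir2|]; first by rewrite undup_uniq.
  rewrite big_seq big1 // => j; rewrite mem_mbelow => le_ji.
  have [->|Fj] := eqVneq (F j) 0; first by rewrite mul0r.
  have [->|Gij] := eqVneq (G (i - j)%MM) 0; first by rewrite mulr0.
  by have := mem_r2 _ _ Fj Gij; rewrite addmC submK // (negPf ir2).
under eq_bigr => i _ do rewrite sum_r big_mkcond.
rewrite exchange_big -Fr mulr_suml; apply: eq_bigr => j _ /=.
have [->|Fj] := eqVneq (F j) 0.
  by rewrite mul0r big1 // => i _; rewrite mul0r if_same.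
(* The [i - j], for [i] in [r2] above [j], are distinct and cover the support of [G] because [F j]
   is nonzero; they sum [G] to [w]. *)
rewrite -big_mkcond -mulr_sumr; congr (_ * _).
rewrite -big_filter -(big_map (fun i => (i - j)%MM) xpredT G).
apply: (has_finite_sum_sub Gw) => [|l].
  rewrite map_inj_in_uniq ?filter_uniq ?undup_uniq // => i i'.
  rewrite !mem_filter => /andP[le_ji _] /andP[le_ji' _] eq_ii'.
  by rewrite -(submK le_ji) eq_ii' submK.
move=> lr; apply/eqP; apply: contraNT lr => Gl.
apply/mapP; exists (j + l)%MM; last by rewrite addmC addmK.
by rewrite mem_filter lem_addr mem_r2.
Qed.

(** * Evaluation at k: Taylor's formula for the shift *)

Section WeylTaylor.
Variables (K : fieldType) (charK0 : [pchar K] =i pred0).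
Variables (n m : nat) (k : 'I_n -> K) (ell : 'I_m -> 'I_n).
Hypothesis ell_inj : injective ell.
Hypothesis ell_support : forall l, k l != 0 -> exists s, ell s = l.
Local Notation weyl := (weyl K n).
Local Notation alpha := (@deform_alpha K n m ell).
Local Notation term := (fun a i => param_power ell k i *: alpha i a).

Lemma param_powerD i j :
  param_power ell k (i + j)%MM = param_power ell k i * param_power ell k j.
Proof.
by rewrite -big_split; apply: eq_bigr => s _; rewrite mnmDE exprD.
Qed.

Lemma param_power0 : param_power ell k 0%MM = 1.
Proof. by rewrite /param_power big1 // => s _; rewrite mnm0E. Qed.

Lemma param_power1 s : param_power ell k U_(s)%MM = k (ell s).
Proof.
rewrite /param_power (bigD1 s) //= mnm1E eqxx expr1 big1 ?mulr1 // => t ts.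
by rewrite mnm1E eq_sym (negPf ts).
Qed.

(** By the Leibniz rule the terms of [a * b] form the Cauchy product of those of [a] and [b], and
    the shift is multiplicative. This reduces the formula to generators. *)
Lemma taylor_sumM (a b : weyl) : has_finite_sum (term a) (weyl_shift k a) ->
    has_finite_sum (term b) (weyl_shift k b) ->
  has_finite_sum (term (a * b)) (weyl_shift k (a * b)).
Proof.
move=> Sa Sb; rewrite rmorphM /=.
suff -> : term (a * b) = fun i => \sum_(j <- mbelow i) term a j * term b (i - j)%MM.
  exact: (has_finite_sum_conv Sa Sb).
apply/funext=> i; rewrite deform_alphaM // scaler_sumr.
apply: eq_big_seq => j; rewrite mem_mbelow => le_ji.
rewrite -[in param_power ell k i](submK le_ji) param_powerD mulrC -scalerA.
by move: (alpha j a) (alpha _ b) => u v; rewrite scalerAr scalerAl.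
Qed.

Lemma taylor_sum_const (a : weyl) : (forall s, weyl_dy (ell s) a = 0) ->
  has_finite_sum (term a) a.
Proof.
move=> a0; have {2}-> : a = term a 0%MM by rewrite param_power0 scale1r deform_alpha0.
apply: has_finite_sum_single => i i0.
by rewrite deform_alpha_dy0 ?scaler0.
Qed.

Lemma deform_alpha_y i s : i != 0%MM ->
  alpha i (weyl_y K (ell s)) = (i == U_(s)%MM)%:R *: (1 : weyl).
Proof.
elim/mnm_add1_ind: i => [|i t IH _]; first by rewrite eqxx.
apply: (@scalerI _ _ (i t).+1%:R); first by move/pcharf0P: charK0 => ->.
rewrite deform_alpha_add1 //; have [->|i0] := eqVneq i 0%MM.
  rewrite deform_alpha0 weyl_dy_y mnm0E scale1r add0m (inj_eq ell_inj).
  by congr (_%:R *: _); rewrite (inj_eq (@mnm1_inj m)).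
rewrite IH // linearZ /= weyl_dy1 scaler0.
(* The left index has degree at least 2, as [i] is nonzero. *)
suff /negPf-> : (i + U_(t) != U_(s))%MM by rewrite scale0r scaler0.
apply: contra_neq i0 => /(congr1 mdeg)/eqP.
by rewrite mdegD !mdeg1 addn1 eqSS mdeg_eq0 => /eqP.
Qed.

Lemma taylor_sum_y i :
  has_finite_sum (term (weyl_y K i)) (weyl_shift k (weyl_y K i)).
Proof.
rewrite weyl_shift_y; have [/existsP[s /eqP <-]|/existsPn ell_i] :=
  boolP [exists s, ell s == i]; last first.
  (* Off the range of [ell] nothing is shifted, and every derivative in use kills y_i. *)
  have -> : k i = 0.
    apply/eqP/negPn/negP => /ell_support[s /eqP].
    by rewrite (negPf (ell_i s)).
  rewrite scale0r addr0; apply: taylor_sum_const => s.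
  by rewrite weyl_dy_y (negPf (ell_i s)) scale0r.
(* The two indices contribute y_i and k_i. *)
apply/has_finite_sumP; exists [:: 0%MM; U_(s)%MM]; split=> [|j|].
- by rewrite /= inE eq_sym mnm1_eq0.
- rewrite !inE negb_or => /andP[j0 /negPf js].
  by rewrite deform_alpha_y // js scale0r scaler0.
rewrite big_cons big_seq1 param_power0 scale1r deform_alpha0.
by rewrite param_power1 deform_alpha_y ?eqxx ?scale1r // mnm1_eq0.
Qed.

Lemma taylor_sum (a : weyl) : has_finite_sum (term a) (weyl_shift k a).
Proof.
elim/weyl_ind: a => [|i a IH|i a IH|c a b IHa IHb].
- by rewrite rmorph1; apply: taylor_sum_const => s; exact: weyl_dy1.
- apply: taylor_sumM IH; rewrite weyl_shift_x.
  by apply: taylor_sum_const => s; exact: weyl_dy_x.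
- by apply: taylor_sumM IH; exact: taylor_sum_y.
rewrite linearP /=.
have -> : term (c *: a + b) = fun i => ( *:%R c \o term a) i + term b i.
  apply/funext=> i /=; rewrite deform_alpha_linear.
  by move: (alpha i a) (alpha i b) => u v; rewrite scalerDr !scalerA mulrC.
by apply: has_finite_sumD IHb; exact: has_finite_sum_additive.
Qed.

End WeylTaylor.

(** * The deformation and its evaluation *)

Lemma alg_mul_bilinear (R : comNzRingType) (A : algType R) :
  @bilinear_map R A ( *%R).
Proof.
split=> c k a b; first by rewrite mulrDl scalerAl.
by rewrite mulrDr scalerAr.
Qed.

Lemma weyl_lie (K : fieldType) (n : nat) :
  hom_lie_algebra (@weyl_bracket K n) id.
Proof. exact: (commutator_lie (@alg_mul_bilinear K (weyl K n)) (@mulrA _)). Qed.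

Theorem corollary2 (K : fieldType) (charK0 : [pchar K] =i pred0)
  (n : nat) (n_gt0 : (0 < n)%N) (k : 'I_n -> K)
  (m : nat) (ell : 'I_m -> 'I_n)
  (ell_increasing : forall s t : 'I_m, (s < t)%N -> (ell s < ell t)%N)
  (ell_support : forall l : 'I_n, k l != 0 <-> exists s : 'I_m, ell s = l) :
  [/\ @formal_hom_lie_deformation K (weyl K n) m
        (@weyl_bracket K n) id (deform_bracket ell) (deform_alpha ell),
      @hom_lie_algebra K (weyl K n) (weyl_hom_bracket k) (weyl_shift k),
      forall a b : weyl K n,
        has_finite_sum (fun i => param_power ell k i *: deform_bracket ell i a b)
          (weyl_hom_bracket k a b)
    & forall a : weyl K n,
        has_finite_sum (fun i => param_power ell k i *: deform_alpha ell i a)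
          (weyl_shift k a)].
Proof.
have ell_inj : injective ell.
  move=> s t eq_st; have [/ell_increasing||/val_inj//] := ltngtP s t.
    by rewrite eq_st ltnn.
  by move/ell_increasing; rewrite eq_st ltnn.
have taylor a := taylor_sum charK0 ell_inj (fun l => (ell_support l).1) a.
have lieW := weyl_lie K n.
have mulL := @alg_mul_bilinear K (weyl K n).
have alphaL i := @deform_alpha_linear K n m ell i.
split=> //.
- split=> //.
  + move=> i; split=> [b|a] c u v; rewrite /deform_bracket.
      by rewrite -alphaL; congr deform_alpha; exact: (hom_lie_bilinear lieW).1.
    by rewrite -alphaL; congr deform_alpha; exact: (hom_lie_bilinear lieW).2.
  + by move=> a b; exact: deform_alpha0.
  + by move=> a; exact: deform_alpha0.
  pose conv := @ms_conv m (weyl K n) (weyl K n) (weyl K n) *%R.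
  (* The deformed bracket becomes the commutator of series followed by the twist, ready for
     [hom_lie_twist]. *)
  have brE : deformed_bracket (deform_bracket ell) =
      fun f g => deformed_twist (deform_alpha ell) (conv f g - conv g f).
    apply/funext=> f; apply/funext=> g; rewrite -ms_conv_commutator.
    exact: deformed_bracket_twist.
  have twistL := deformed_twist_linear alphaL.
  rewrite brE; apply: hom_lie_twist => //.
    apply: commutator_lie; first exact: ms_conv_bilinear.
    by apply: (ms_conv_assoc mulL); exact: mulrA.
  have twistM : {morph deformed_twist (deform_alpha ell) : f g / conv f g}.
    by apply: deformed_twist_morph => // i a b; exact: deform_alphaM.
  by move=> f g; rewrite (linear_propB twistL) !twistM.
(* By additivity of the shift, this bracket is likewise a Lie bracket followed by an
   endomorphism. *)
- have -> : weyl_hom_bracket k = fun a b => weyl_shift k (weyl_bracket a b).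
    apply/funext=> a; apply/funext=> b.
    by rewrite /weyl_hom_bracket /weyl_hom_mul -raddfB.
  apply: hom_lie_twist => //; first exact: linearP.
  by move=> a b; rewrite /weyl_bracket [LHS]raddfB; congr (_ - _); exact: rmorphM.
(* This is Taylor's formula at [a * b - b * a]. *)
by move=> a b; rewrite /weyl_hom_bracket /weyl_hom_mul -raddfB; exact: taylor.
Qed.
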